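(* Let $d,n,p$ be positive integers and $\gamma>0$ with $n\ge d$ and $p\ge \max(17n,\,1/\gamma)$. Fix $\theta\in\mathbb{R}^d$ and a matrix $W\in\mathbb{R}^{p\times d}$ with $W^\top W=p\gamma I_d$. Let tasks A and B, the estimators $\hat\beta_A,\hat\beta_B,\hat\beta_{BA}$ and the task-A risk $R$ be as defined in the context. Then there is a universal constant $c>0$ such that, with probability at least $1-10e^{-cd}$ (over the draw of the training data and of $O$), $$R(\hat\beta_{BA})-R(\hat\beta_A)\le\left(66\sqrt{\frac{n}{p}}+\frac{12}{p\gamma}\right)\|\theta\|^2 .$$
   Context: Latent space model: $W\in\mathbb{R}^{p\times d}$ is fixed. A single example is generated by $z\sim\mathcal N(0,I_d)$, $u\sim\mathcal N(0,I_p)$ independent, $x=Wz+u\in\mathbb{R}^p$, $y=z^\top\theta\in\mathbb{R}$. Task A: $n$ i.i.d. examples $(x_i,y_i)$; $X_A\in\mathbb{R}^{n\times p}$ has rows $x_i^\top$ and $y=(y_1,\dots,y_n)^\top$. Let $O$ be a Haar-distributed random $p\times p$ orthogonal matrix independent of the data. Task B has data $(X_B,y)$ with $X_B=X_AO^\top$. For a matrix $M$, $\mathcal P_{M}$ denotes the orthogonal projection onto the range (column space) of $M$. Estimators (well defined since $X_A$ has rank $n$ almost surely when $n<p$): $\hat\beta_A=X_A^\top(X_AX_A^\top)^{-1}y$ (the minimum-norm interpolator of task A), $\hat\beta_B=X_B^\top(X_BX_B^\top)^{-1}y$, and $\hat\beta_{BA}=\hat\beta_A+\hat\beta_B-\mathcal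 P_{X_B^\top}\hat\beta_A$, which is the minimizer of $\|b-\hat\beta_A\|^2$ subject to $X_Bb=y$. Define $\Sigma=WW^\top+I_p$, $\beta=W(W^\top W+I_d)^{-1}\theta$, $\sigma^2=\theta^\top(W^\top W+I_d)^{-1}\theta$. The task-A risk of a parameter vector $b\in\mathbb{R}^p$ (for the linear predictor $x\mapsto x^\top b$) is $R(b)=\mathbb{E}_{(x,y)}[(x^\top b-y)^2]$ for a fresh example $(x,y)$ from the task-A distribution, which equals $\sigma^2+(b-\beta)^\top\Sigma(b-\beta)$. *)

(* Defs.v *)
From HB Require Import structures.
From mathcomp Require Import all_boot all_order all_algebra.
From mathcomp Require Import all_classical all_reals all_analysis.
Set Implicit Arguments. Unset Strict Implicit. Unset Printing Implicit Defensive.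
Import Order.TTheory GRing.Theory Num.Theory.
Local Open Scope classical_set_scope.
Local Open Scope ring_scope.

Section Model.
Context {R : realType}.

Definition mutually_independent {d0} {T : measurableType d0} (P : probability T R)
  (I : finType) (X : I -> T -> R) : Prop :=
  forall B : I -> set R, (forall i, measurable (B i)) ->
    P (\bigcap_(i in [set: I]) (X i @^-1` B i)) =
    (\prod_(i : I) P (X i @^-1` B i))%E.

Definition std_normal_rv {d0} {T : measurableType d0} (P : probability T R)
  (X : T -> R) : Prop :=
  forall B : set R, measurable B -> P (X @^-1` B) = normal_prob 0 1 B.

(* Independence of the random vectors (X i)_i and (Y j)_j: product rule on
   all (Borel) rectangle events, which form a pi-system generating the
   sigma-algebras sigma(X) and sigma(Y). *)
Definition independent_vectors {d0} {T : measurableType d0} (P : probability T R)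
  (I J : finType) (X : I -> T -> R) (Y : J -> T -> R) : Prop :=
  forall (B : I -> set R) (C : J -> set R),
    (forall i, measurable (B i)) -> (forall j, measurable (C j)) ->
    P (\bigcap_(i in [set: I]) (X i @^-1` B i) `&`
       \bigcap_(j in [set: J]) (Y j @^-1` C j)) =
    (P (\bigcap_(i in [set: I]) (X i @^-1` B i)) *
     P (\bigcap_(j in [set: J]) (Y j @^-1` C j)))%E.

Definition orthogonal_mx (p : nat) (Q : 'M[R]_p) : Prop := Q *m Q^T = 1%:M.

(* O is Haar-distributed on the orthogonal group O(p): O is orthogonal and its
   law (determined by its values on Borel rectangles of R^{p x p}) is invariant
   under left multiplication by any fixed orthogonal matrix; by uniqueness of
   Haar measure on the compact group O(p) this characterizes the Haar law. *)
Definition haar_orthogonal {d0} {T : measurableType d0} (P : probability T R)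
  (p : nat) (O : T -> 'M[R]_p) : Prop :=
  (forall t, orthogonal_mx (O t)) /\
  forall Q : 'M[R]_p, orthogonal_mx Q ->
  forall C : 'I_p * 'I_p -> set R, (forall k, measurable (C k)) ->
    P (\bigcap_(k in [set: 'I_p * 'I_p]) [set t | (Q *m O t) k.1 k.2 \in C k]) =
    P (\bigcap_(k in [set: 'I_p * 'I_p]) [set t | O t k.1 k.2 \in C k]).

Definition ZU_entries {T : Type} (n d p : nat) (Z : T -> 'M[R]_(n, d))
  (U : T -> 'M[R]_(n, p)) : ('I_n * 'I_d) + ('I_n * 'I_p) -> T -> R :=
  fun k t => match k with inl ij => Z t ij.1 ij.2 | inr ij => U t ij.1 ij.2 end.

Definition O_entries {T : Type} (p : nat) (O : T -> 'M[R]_p) :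
  'I_p * 'I_p -> T -> R := fun k t => O t k.1 k.2.

(* Design matrix of task A: rows x_i^T = z_i^T W^T + u_i^T. *)
Definition XA (n d p : nat) (W : 'M[R]_(p, d)) (Z : 'M[R]_(n, d)) (U : 'M[R]_(n, p))
  : 'M[R]_(n, p) := Z *m W^T + U.

Definition yvec (n d : nat) (theta : 'cV[R]_d) (Z : 'M[R]_(n, d)) : 'cV[R]_n :=
  Z *m theta.

Definition minnorm (n p : nat) (X : 'M[R]_(n, p)) (y : 'cV[R]_n) : 'cV[R]_p :=
  X^T *m invmx (X *m X^T) *m y.

(* Orthogonal projection onto the column space of M : p x n (M of full column
   rank n, as is the case almost surely here): M (M^T M)^{-1} M^T. *)
Definition colproj (p n : nat) (M : 'M[R]_(p, n)) : 'M[R]_p :=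
  M *m invmx (M^T *m M) *m M^T.

Definition beta_BA (n p : nat) (XA XB : 'M[R]_(n, p)) (y : 'cV[R]_n) : 'cV[R]_p :=
  minnorm XA y + minnorm XB y - colproj XB^T *m minnorm XA y.

Definition Sigma (p d : nat) (W : 'M[R]_(p, d)) : 'M[R]_p := W *m W^T + 1%:M.

Definition beta_star (p d : nat) (W : 'M[R]_(p, d)) (theta : 'cV[R]_d) : 'cV[R]_p :=
  W *m invmx (W^T *m W + 1%:M) *m theta.

Definition sigma2 (p d : nat) (W : 'M[R]_(p, d)) (theta : 'cV[R]_d) : R :=
  (theta^T *m invmx (W^T *m W + 1%:M) *m theta) ord0 ord0.

(* Task-A risk R(b) = E[(x^T b - y)^2] = sigma^2 + (b-beta)^T Sigma (b-beta). *)
Definition riskA (p d : nat) (W : 'M[R]_(p, d)) (theta : 'cV[R]_d) (b : 'cV[R]_p) : R :=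
  sigma2 W theta +
  ((b - beta_star W theta)^T *m Sigma W *m (b - beta_star W theta)) ord0 ord0.

Definition sqnorm (d : nat) (v : 'cV[R]_d) : R := \sum_(i < d) v i ord0 ^+ 2.

End Model.

(* Main.v *)
Require Import Defs.
From HB Require Import structures.
From mathcomp Require Import all_boot all_order all_algebra.
From mathcomp Require Import all_classical all_reals all_analysis.
From mathcomp Require Import measurable_realfun ring lra zify.
Import Order.TTheory GRing.Theory Num.Theory.
Import numFieldNormedType.Exports.
Local Open Scope classical_set_scope.
Local Open Scope ring_scope.
Set Implicit Arguments.
Unset Strict Implicit.
Unset Printing Implicit Defensive.

(** Write A = W^T / s with s^2 = p gamma, q = sqrt (n / p), e = beta_A and let P
    be the projection onto the row space of X_A.  Then beta_BA = e + delta with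
    delta = O e - O P O^T e, and the risk gap equals
      |e|^2 - |P O^T e|^2 + |W^T delta|^2 + 2 (W^T delta) . (W^T e - theta),
    which is at most (64 q + 4 / s^2) |theta|^2 as soon as |e| <= 2 |theta| / s,
    |A O e| <= 2 q |e| and |P O^T e| <= 2 q |e|.
    The first bound holds for every Z once some b satisfies W^T b = theta, U b = 0
    and |b| <= 2 |theta| / s, because b then interpolates the data; b is obtained
    from W theta / s^2 by projecting away the rows of U one at a time, the norm
    growing at each step by a factor with controlled n-th moment.  The other two
    bounds follow from invariance: a Haar rotation of a fixed vector may be
    averaged over a Gaussian vector, or over a second independent rotation, and
    Gaussian projections concentrate.  The failure probability is at most
    6 exp (- n / 8). *)

(** * Measurability of matrix operations *)

(** Bounding |e| usually means bounding the smallest singular value of X_A from below. Asking only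
    for some short interpolator avoids this: the rows of U are processed one at a time, and each
    calls for a single Gaussian integral. The same construction yields the linear independence of
    the rows of X_A, so invertibility of the Gram matrix is part of the event rather than a separate
    almost sure statement. A row multiplies |b|^2 by 1 + g / |r|^2, where g is the square of one
    Gaussian coordinate and |r|^2 > p / 4 off a rare event. The n-th power is the compromise: it is
    at most exp (4 n g / p) <= exp (g / 4) by 17 n <= p, with mean at most sqrt 2, and starting from
    a quarter of the allowed squared norm it leaves (sqrt 2 / 4) ^ n after n rows. Haar measure
    enters through left invariance alone. This rotates the argument of O^T but not that of O, which
    is why O e needs a second rotation. Since e depends on the data, both rotation bounds are proved
    for fixed data and then integrated using independence. *)

Section MatrixMeasurable.
Variables (R : realType) (m n : nat).

Definition mx_rect (C : 'I_m -> 'I_n -> set R) : set 'M[R]_(m, n) :=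
  [set M | forall i j, C i j (M i j)].

Definition mx_rects : set (set 'M[R]_(m, n)) :=
  [set S | exists2 C, (forall i j, measurable (C i j)) & S = mx_rect C].

(** Haar invariance and independence are assumed on rectangles. Rectangles form a pi-system, so with
    this sigma-algebra [mx_rects_unique] extends such identities to all measurable sets. *)
Definition mx_measurable : set (set 'M[R]_(m, n)) := <<s mx_rects >>.

Let mx_measurable0 : mx_measurable set0.
Proof. exact: sigma_algebra0. Qed.

Let mx_measurableC A : mx_measurable A -> mx_measurable (~` A).
Proof. by move=> mA; rewrite -setTD; exact: sigma_algebraCD. Qed.

Let mx_measurable_bigcup (F : (set 'M[R]_(m, n))^nat) :
  (forall i, mx_measurable (F i)) -> mx_measurable (\bigcup_i F i).
Proof. exact: sigma_algebra_bigcup. Qed.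

HB.instance Definition _ := @isMeasurable.Build default_measure_display
  'M[R]_(m, n) mx_measurable mx_measurable0 mx_measurableC mx_measurable_bigcup.

Lemma mx_rects_setI : setI_closed mx_rects.
Proof.
move=> _ _ [C mC ->] [D mD ->]; exists (fun i j => C i j `&` D i j).
  by move=> i j; exact: measurableI.
apply/seteqP; split=> [M [CM DM] i j|M CDM]; first by split.
by split=> i j; have [] := CDM i j.
Qed.

Lemma measurable_mx_rect C : (forall i j, measurable (C i j)) ->
  measurable (mx_rect C).
Proof. by move=> mC; apply: sub_sigma_algebra; exists C. Qed.

Lemma measurable_entry i j : measurable_fun setT (fun M : 'M[R]_(m, n) => M i j).
Proof.
move=> _ B mB; rewrite setTI.
have -> : (fun M : 'M[R]_(m, n) => M i j) @^-1` B =
  mx_rect (fun a b => if (a == i) && (b == j) then B else setT).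
  apply/seteqP; split=> M /= => [BM a b|/(_ i j)]; last by rewrite !eqxx.
  by case: ifP => // /andP[/eqP-> /eqP->].
by apply: measurable_mx_rect => a b; case: ifP.
Qed.

Lemma measurable_mxP d (T : measurableType d) (f : T -> 'M[R]_(m, n)) :
  measurable_fun setT f <-> forall i j, measurable_fun setT (fun t => f t i j).
Proof.
split=> [mf i j|mf]; first exact: (measurableT_comp (measurable_entry i j)).
apply: (@measurability _ _ _ _ _ _ mx_rects) => //.
move=> _ [_ [C mC ->] <-]; rewrite setTI.
have -> : f @^-1` mx_rect C =
    \bigcap_(k in [set: 'I_m * 'I_n]) ((fun t => f t k.1 k.2) @^-1` C k.1 k.2).
  by apply/seteqP; split=> [t Ct [i j] _|t Ct i j]; [exact: Ct|exact: (Ct (i, j))].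
apply: fin_bigcap_measurable => [|[i j] _]; first exact: finite_finset.
by rewrite -[X in measurable X]setTI; exact: mf.
Qed.

Lemma mx_rects_unique (mu nu : {measure set 'M[R]_(m, n) -> \bar R}) :
  (mu setT < +oo)%E ->
  (forall C, (forall i j, measurable (C i j)) -> mu (mx_rect C) = nu (mx_rect C)) ->
  forall A, measurable A -> mu A = nu A.
Proof.
move=> mufin munu A mA.
have rT : mx_rect (fun _ _ => setT) = setT by apply/seteqP; split.
apply: (measure_unique mx_rects (fun=> setT)) => //.
- exact: mx_rects_setI.
- by move=> _; exists (fun _ _ => setT).
- by rewrite bigcup_const //; exists 0%N.
- by move=> _ [C mC ->]; exact: munu.
Qed.

End MatrixMeasurable.

Section MatrixMeasurableFun.
Context {R : realType} {d : measure_display} {T : measurableType d}.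

Lemma measurable_funV (f : T -> R) :
  measurable_fun setT f -> measurable_fun setT (fun t => (f t)^-1).
Proof.
move=> mf.
(* This form reduces inversion to [measurable_powR]; where [f] vanishes both sides are 0, by the
   convention for the inverse of 0. *)
have -> : (fun t => (f t)^-1) = (fun t => f t * ((f t ^+ 2) `^ (-1))).
  apply/funext => t; rewrite powR_inv1 ?sqr_ge0// expr2 invfM mulrA.
  by have [->|f0] := eqVneq (f t) 0; rewrite ?invr0 ?mulr0// divff// mul1r.
apply: measurable_funM => //.
exact: measurableT_comp (measurable_powR _) (measurable_funX _ _).
Qed.

Lemma measurable_mulmx m n p (f : T -> 'M[R]_(m, n)) (g : T -> 'M[R]_(n, p)) :
  measurable_fun setT f -> measurable_fun setT g ->
  measurable_fun setT (fun t => f t *m g t).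
Proof.
move=> /measurable_mxP mf /measurable_mxP mg; apply/measurable_mxP => i j.
under eq_fun do rewrite mxE.
by apply: measurable_sum => k; apply: measurable_funM.
Qed.

Lemma measurable_addmx m n (f g : T -> 'M[R]_(m, n)) :
  measurable_fun setT f -> measurable_fun setT g ->
  measurable_fun setT (fun t => f t + g t).
Proof.
move=> /measurable_mxP mf /measurable_mxP mg; apply/measurable_mxP => i j.
under eq_fun do rewrite mxE.
by apply: measurable_funD.
Qed.

Lemma measurable_oppmx m n (f : T -> 'M[R]_(m, n)) :
  measurable_fun setT f -> measurable_fun setT (fun t => - f t).
Proof.
move=> /measurable_mxP mf; apply/measurable_mxP => i j.
under eq_fun do rewrite mxE.
by apply: measurable_funN.
Qed.

Lemma measurable_scalemx m n (c : T -> R) (f : T -> 'M[R]_(m, n)) :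
  measurable_fun setT c -> measurable_fun setT f ->
  measurable_fun setT (fun t => c t *: f t).
Proof.
move=> mc /measurable_mxP mf; apply/measurable_mxP => i j.
under eq_fun do rewrite mxE.
by apply: measurable_funM.
Qed.

Lemma measurable_trmx m n (f : T -> 'M[R]_(m, n)) :
  measurable_fun setT f -> measurable_fun setT (fun t => (f t)^T).
Proof.
move=> /measurable_mxP mf; apply/measurable_mxP => i j.
under eq_fun do rewrite mxE.
by apply: mf.
Qed.

Lemma measurable_col_mx m1 m2 n (f : T -> 'M[R]_(m1, n)) (g : T -> 'M[R]_(m2, n)) :
  measurable_fun setT f -> measurable_fun setT g ->
  measurable_fun setT (fun t => col_mx (f t) (g t)).
Proof.
move=> /measurable_mxP mf /measurable_mxP mg; apply/measurable_mxP => i j.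
under eq_fun do rewrite mxE.
by case: (fintype.split _) => k; [exact: mf|exact: mg].
Qed.

Lemma measurable_row_mx m n1 n2 (f : T -> 'M[R]_(m, n1)) (g : T -> 'M[R]_(m, n2)) :
  measurable_fun setT f -> measurable_fun setT g ->
  measurable_fun setT (fun t => row_mx (f t) (g t)).
Proof.
move=> /measurable_mxP mf /measurable_mxP mg; apply/measurable_mxP => i j.
under eq_fun do rewrite mxE.
by case: (fintype.split _) => k; [exact: mf|exact: mg].
Qed.

Lemma measurable_lsubmx m n1 n2 (f : T -> 'M[R]_(m, n1 + n2)) :
  measurable_fun setT f -> measurable_fun setT (fun t => lsubmx (f t)).
Proof.
move=> /measurable_mxP mf; apply/measurable_mxP => i j.
under eq_fun do rewrite mxE.
by apply: mf.
Qed.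

Lemma measurable_rsubmx m n1 n2 (f : T -> 'M[R]_(m, n1 + n2)) :
  measurable_fun setT f -> measurable_fun setT (fun t => rsubmx (f t)).
Proof.
move=> /measurable_mxP mf; apply/measurable_mxP => i j.
under eq_fun do rewrite mxE.
by apply: mf.
Qed.

Lemma measurable_det n (f : T -> 'M[R]_n) :
  measurable_fun setT f -> measurable_fun setT (fun t => \det (f t)).
Proof.
move=> /measurable_mxP mf; apply: measurable_sum => s.
apply: measurable_funM; first exact: measurable_cst.
by apply: measurable_prod => i _; apply: mf.
Qed.

Lemma measurable_invmx n (f : T -> 'M[R]_n) :
  measurable_fun setT f -> measurable_fun setT (fun t => invmx (f t)).
Proof.
move=> mf; rewrite /invmx; apply: measurable_fun_ifT => //.
  under eq_fun do rewrite unitmxE unitfE.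
  apply: measurable_neg; apply: measurable_fun_eqr => //.
  exact: measurable_det.
apply: measurable_scalemx; first by apply/measurable_funV/measurable_det.
apply/measurable_mxP => i j; under eq_fun do rewrite mxE /cofactor.
apply: measurable_funM => //; apply: measurable_det.
apply/measurable_mxP => a b; under eq_fun do rewrite !mxE.
by move/measurable_mxP: mf; apply.
Qed.

Lemma measurable_sqnorm n (f : T -> 'cV[R]_n) :
  measurable_fun setT f -> measurable_fun setT (fun t => sqnorm (f t)).
Proof.
move=> /measurable_mxP mf; apply: measurable_sum => i.
by apply: measurable_funX; apply: mf.
Qed.

Lemma measurable_minnorm m n (f : T -> 'M[R]_(m, n)) (g : T -> 'cV[R]_m) :
  measurable_fun setT f -> measurable_fun setT g ->
  measurable_fun setT (fun t => minnorm (f t) (g t)).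
Proof.
move=> mf mg; apply: measurable_mulmx => //; apply: measurable_mulmx.
  exact: measurable_trmx.
by apply: measurable_invmx; apply: measurable_mulmx => //; exact: measurable_trmx.
Qed.

Lemma measurable_set_bool (f : T -> bool) :
  measurable_fun setT f -> measurable [set t | f t].
Proof.
move=> mf; rewrite -[X in measurable X]setTI.
by apply: (mf measurableT [set true]).
Qed.

Lemma measurable_set_ler (f g : T -> R) :
  measurable_fun setT f -> measurable_fun setT g ->
  measurable [set t | f t <= g t].
Proof.
by move=> mf mg; apply: measurable_set_bool; apply: measurable_fun_ler.
Qed.

Lemma measurable_set_ltr (f g : T -> R) :
  measurable_fun setT f -> measurable_fun setT g ->
  measurable [set t | f t < g t].
Proof.
by move=> mf mg; apply: measurable_set_bool; apply: measurable_fun_ltr.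
Qed.

Lemma measurable_set_unitmx n (f : T -> 'M[R]_n) :
  measurable_fun setT f -> measurable [set t | f t \in unitmx].
Proof.
move=> mf; apply: measurable_set_bool; under eq_fun do rewrite unitmxE unitfE.
by apply: measurable_neg; apply: measurable_fun_eqr => //; exact: measurable_det.
Qed.

End MatrixMeasurableFun.

(** * Gaussian vectors and matrices *)

Section Density.
Local Open Scope ereal_scope.
Context {d : measure_display} {T : measurableType d} {R : realType}.
Variables (mu nu : {measure set T -> \bar R}) (g : T -> R).
Hypothesis mg : measurable_fun setT g.
Hypothesis g0 : forall x, (0 <= g x)%R.
Hypothesis nuE : forall A, measurable A -> nu A = \int[mu]_(x in A) (g x)%:E.

Import HBNNSimple.

Let integral_density_nnsfun (f : {nnsfun T >-> R}) :
  \int[nu]_x (f x)%:E = \int[mu]_x ((f x)%:E * (g x)%:E).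
Proof.
under [LHS]eq_integral do rewrite fimfunE -fsumEFin//.
rewrite [LHS]ge0_integral_fsum//; last 2 first.
  - by move=> r; exact/measurable_EFinP/measurableT_comp.
  - by move=> n x _; rewrite EFinM nnfun_muleindic_ge0.
under [RHS]eq_integral.
  move=> x _; rewrite fimfunE -fsumEFin// muleC ge0_mule_fsumr; last first.
    by move=> r; rewrite EFinM nnfun_muleindic_ge0.
  over.
rewrite [RHS]ge0_integral_fsum//; last 2 first.
  - move=> r; apply: emeasurable_funM; first exact/measurable_EFinP.
    exact/measurable_EFinP/measurableT_comp.
  - move=> n x _; rewrite mule_ge0 ?lee_fin//.
    by have := nnfun_muleindic_ge0 f n x; rewrite -EFinM lee_fin.
apply: eq_fsbigr => r /[!inE] -[x _ <-].
under [RHS]eq_integral do rewrite EFinM muleCA.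
rewrite integralZl_indic_nnsfun//.
rewrite [RHS]ge0_integralZl//; last 3 first.
  - apply: emeasurable_funM; first exact/measurable_EFinP.
    by apply/measurable_EFinP; exact: measurable_indic.
  - by move=> t _; rewrite mule_ge0// lee_fin.
  - by rewrite lee_fin.
congr (_ * _).
rewrite integral_indic// setIT nuE// [LHS]integral_mkcond.
apply: eq_integral => t _; rewrite patchE indicE.
by case: ifP => tA; rewrite (mule1, mule0).
Qed.

(** Simple functions first, then monotone convergence. It turns integrals against the normal law
    into Lebesgue integrals. *)
Lemma ge0_integral_density (f : T -> \bar R) :
  measurable_fun setT f -> (forall x, 0 <= f x) ->
  \int[nu]_x f x = \int[mu]_x (f x * (g x)%:E).
Proof.
move=> mf f0; pose f_ := nnsfun_approx measurableT mf.
transitivity (lim (\int[nu]_x (f_ n x)%:E @[n --> \oo])).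
  rewrite -monotone_convergence//=.
  - apply: eq_integral => ? /[!inE] xD; apply/esym/cvg_lim => //=.
    exact: cvg_nnsfun_approx.
  - by move=> n; exact/measurable_EFinP/measurable_funTS.
  - by move=> n ? _; rewrite lee_fin.
  - by move=> ? _ ? ? mn; rewrite lee_fin; exact/lefP/nd_nnsfun_approx.
under eq_fun do rewrite integral_density_nnsfun.
rewrite -monotone_convergence//=.
- apply: eq_integral => x _; apply/cvg_lim => //=.
  apply: cvgeZr => //; exact: cvg_nnsfun_approx.
- move=> n; apply: emeasurable_funM; last exact/measurable_EFinP.
  exact/measurable_EFinP.
- by move=> n x _; rewrite mule_ge0// lee_fin.
- move=> x _ m n mn; rewrite lee_wpmul2r ?lee_fin//.
  exact/lefP/nd_nnsfun_approx.
Qed.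

End Density.

(** Completing the square: times the standard density, the integrand is a constant multiple of the
    density of N(w s^2, s^2). Parametrizing the quadratic coefficient by [s] keeps it below 1/2, so
    integrability needs no further condition. *)
Lemma integral_normal_prob_expR (R : realType) (s w : R) : 0 < s ->
  (\int[normal_prob 0 1]_x (expR ((1 - s ^- 2) / 2 * x ^+ 2 + w * x))%:E =
   (s * expR (w ^+ 2 * s ^+ 2 / 2))%:E)%E.
Proof.
move=> s0; have sn0 : s != 0 by rewrite gt_eqF.
have mexp : measurable_fun [set: R]
    (fun x => expR ((1 - s ^- 2) / 2 * x ^+ 2 + w * x)).
  apply: measurableT_comp => //; apply: measurable_funD.
    by apply: measurable_funM => //; exact: measurable_funX.
  exact: measurable_funM.
rewrite (@ge0_integral_density _ _ _ lebesgue_measure _ (normal_pdf 0 1))//.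
- transitivity (\int[lebesgue_measure]_x ((s * expR (w ^+ 2 * s ^+ 2 / 2))%:E *
    (normal_pdf (w * s ^+ 2) s x)%:E))%E.
    apply: eq_integral => x _; rewrite -!EFinM; congr EFin.
    rewrite !normal_pdfE ?oner_neq0// /normal_peak /normal_fun.
    have -> : Num.sqrt (s ^+ 2 * pi *+ 2) = s * Num.sqrt (1 ^+ 2 * pi *+ 2).
      by rewrite -mulrnAr sqrtrM ?sqr_ge0// sqrtr_sqr gtr0_norm// expr1n mul1r.
    set c := Num.sqrt _; have c0 : c != 0.
      by rewrite gt_eqF// sqrtr_gt0 expr1n mul1r mulrn_wgt0// pi_gt0.
    set N := expR (- (x - _ * _) ^+ 2 / _); set E := expR (_ * _ / 2).
    have -> : s * E * ((s * c)^-1 * N) = c^-1 * (E * N) by field; exact/andP.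
    rewrite mulrCA -!expRD; congr (_ * expR _).
    by field.
  rewrite ge0_integralZl//; last 3 first.
  + by apply/measurable_EFinP; exact: measurable_normal_pdf.
  + by move=> x _; rewrite lee_fin normal_pdf_ge0.
  + by rewrite lee_fin mulr_ge0 ?expR_ge0 ?ltW.
  by rewrite integral_normal_pdf mule1.
- exact: measurable_normal_pdf.
- by move=> x; exact: normal_pdf_ge0.
- exact/measurable_EFinP.
Qed.

Section ImageProbability.
Context {d1 d2 : measure_display} {T1 : measurableType d1} {T2 : measurableType d2}.
Context {R : realType}.

Definition image_prob (P : probability T1 R) (f : T1 -> T2)
    (mf : measurable_fun setT f) : probability T2 R :=
  distribution P (mfun_Sub (mem_set mf)).

Lemma image_probE (P : probability T1 R) (f : T1 -> T2) (mf : measurable_fun setT f) A :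
  image_prob P mf A = P (f @^-1` A).
Proof. by []. Qed.

Lemma ge0_integral_image_prob (P : probability T1 R) (f : T1 -> T2)
    (mf : measurable_fun setT f) (g : T2 -> \bar R) :
  measurable_fun setT g -> (forall x, 0 <= g x)%E ->
  (\int[image_prob P mf]_y g y = \int[P]_x g (f x))%E.
Proof. by move=> mg g0; rewrite ge0_integral_distribution. Qed.

End ImageProbability.

(** * Random matrices with independent rows *)

Section IidRows.
Context {R : realType} {p : nat}.

Lemma measurable_col_mx_pair k :
  measurable_fun setT (fun z : 'rV[R]_p * 'M[R]_(k, p) => (col_mx z.1 z.2 : 'M[R]_(k.+1, p))).
Proof. exact: (measurable_col_mx measurable_fst measurable_snd). Qed.

(** The recursion peels off the first row, which is the conditioning that the row-by-row extension
    argument uses. *)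
Fixpoint iid_rows (mu : probability 'rV[R]_p R) k : probability 'M[R]_(k, p) R :=
  if k is k'.+1 then
    image_prob (mu \x iid_rows mu k')%E (@measurable_col_mx_pair k')
  else dirac (0 : 'M[R]_(0, p)).

Lemma iid_rowsS_integral (mu : probability 'rV[R]_p R) k (f : 'M[R]_(k.+1, p) -> \bar R) :
  measurable_fun setT f -> (forall M, 0 <= f M)%E ->
  (\int[iid_rows mu k.+1]_M f M =
   \int[mu]_u \int[iid_rows mu k]_V f (col_mx u V : 'M[R]_(k.+1, p)))%E.
Proof.
move=> mf f0; rewrite /= ge0_integral_image_prob//.
rewrite fubini_tonelli1//.
exact: (measurableT_comp mf (@measurable_col_mx_pair k)).
Qed.

Lemma iid_rows_prod (mu : probability 'rV[R]_p R) k (F : 'I_k -> 'rV[R]_p -> \bar R) :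
  (forall i, measurable_fun setT (F i)) -> (forall i u, 0 <= F i u)%E ->
  (\int[iid_rows mu k]_M (\prod_(i < k) F i (row i M)) =
   \prod_(i < k) \int[mu]_u F i u)%E.
Proof.
elim: k F => [|k IH] F mF F0.
  rewrite big_ord0 (eq_integral (cst 1%E)); last by move=> M _; rewrite big_ord0.
  rewrite integral_cst// mul1e; exact: probability_setT.
have mrow m (i : 'I_m) : measurable_fun setT (fun M : 'M[R]_(m, p) => row i M).
  apply/measurable_mxP => a b; under eq_fun do rewrite mxE.
  exact: measurable_entry.
have mprod m (G : 'I_m -> 'rV[R]_p -> \bar R) : (forall i, measurable_fun setT (G i)) ->
    measurable_fun setT (fun M : 'M[R]_(m, p) => \prod_(i < m) G i (row i M))%E.
  move=> mG; elim: (index_enum _) => [|i s IHs].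
    by under eq_fun do rewrite big_nil; exact: measurable_cst.
  under eq_fun do rewrite big_cons; apply: emeasurable_funM => //.
  exact: (measurableT_comp (mG i) (mrow _ i)).
rewrite iid_rowsS_integral; last 2 first.
- exact: mprod.
- by move=> M; apply: prode_ge0 => i _; exact: F0.
rewrite big_ord_recl.
have P0 : (0 <= \prod_(i < k) \int[mu]_u F (lift ord0 i) u)%E.
  by apply: prode_ge0 => i _; apply: integral_ge0 => u _; exact: F0.
rewrite -ge0_integralZr//; apply: eq_integral => u _.
rewrite -IH//; under eq_integral do rewrite big_ord_recl.
rewrite -ge0_integralZl//.
- apply: eq_integral => V _; congr (_ * _)%E.
    congr (F _ _); apply/rowP => j; rewrite mxE -[RHS](col_mxEu u V ord0 j).
    by congr (col_mx u V _ j); apply: val_inj.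
  apply: eq_bigr => i _; congr (F _ _); apply/rowP => j.
  rewrite [LHS]mxE [RHS]mxE -[RHS](col_mxEd u V i j).
  by congr (col_mx u V _ j); apply: val_inj.
- exact: (mprod _ (fun i => F (lift ord0 i))).
- by move=> M _; apply: prode_ge0 => i _; exact: F0.
Qed.

End IidRows.

Section Gaussian.
Context {R : realType}.
Local Notation std := (normal_prob (0 : R) 1).

Lemma measurable_scalar_mx1 :
  measurable_fun setT (fun x : R => (x%:M : 'rV[R]_1)).
Proof.
apply/measurable_mxP => i j; under eq_fun do rewrite mxE !ord1 eqxx mulr1n.
exact: measurable_id.
Qed.

(** A column is a matrix whose rows have one entry, so the same construction serves for vectors and
    for matrices. *)
Definition gauss_col p : probability 'cV[R]_p R :=
  iid_rows (image_prob std measurable_scalar_mx1) p.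

Definition gauss_row p : probability 'rV[R]_p R :=
  image_prob (gauss_col p) (measurable_trmx (@measurable_id _ 'cV[R]_p setT)).

Definition gauss_mx n p : probability 'M[R]_(n, p) R := iid_rows (gauss_row p) n.

Lemma gauss_col_prod p (F : 'I_p -> R -> \bar R) :
  (forall i, measurable_fun setT (F i)) -> (forall i x, 0 <= F i x)%E ->
  (\int[gauss_col p]_g (\prod_(i < p) F i (g i ord0)) =
   \prod_(i < p) \int[std]_x F i x)%E.
Proof.
move=> mF F0.
have mF' i : measurable_fun setT (fun u : 'rV[R]_1 => F i (u ord0 ord0)).
  exact: (measurableT_comp (mF i) (measurable_entry ord0 ord0)).
transitivity (\int[gauss_col p]_g
    (\prod_(i < p) (fun u : 'rV[R]_1 => F i (u ord0 ord0)) (row i g)))%E.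
  by apply: eq_integral => g _; apply: eq_bigr => i _; rewrite mxE.
rewrite (@iid_rows_prod _ _ _ _ (fun i (u : 'rV[R]_1) => F i (u ord0 ord0)))//.
apply: eq_bigr => i _; rewrite ge0_integral_image_prob//.
by apply: eq_integral => x _; rewrite mxE eqxx mulr1n.
Qed.

(** It matches this concrete law with that of the noise, whose entries are known only through their
    joint independence and normality. *)
Lemma gauss_mx_rect n p (C : 'I_n -> 'I_p -> set R) :
  (forall i j, measurable (C i j)) ->
  gauss_mx n p (mx_rect C) = (\prod_(i < n) \prod_(j < p) std (C i j))%E.
Proof.
move=> mC.
have indic_rect m q (D : 'I_m -> 'I_q -> set R) (M : 'M[R]_(m, q)) :
    ((\1_(mx_rect D) M)%:E : \bar R) = (\prod_(i < m) \prod_(j < q) (\1_(D i j) (M i j))%:E)%E.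
  under eq_bigr do rewrite prodEFin; rewrite prodEFin; congr EFin.
  rewrite !indicE; have [|] := boolP (M \in mx_rect D).
    rewrite inE => DM; rewrite big1// => i _; rewrite big1// => j _.
    by rewrite indicE mem_set//; exact: DM.
  rewrite notin_setE => nDM; apply/esym/eqP.
  have [i [j nD]] : exists i j, ~ D i j (M i j).
    by move: nDM => /existsNP[i /existsNP[j]]; exists i, j.
  rewrite (bigD1 i)//= (bigD1 j)//= indicE memNset//.
  by rewrite !mul0r.
pose F i (u : 'rV[R]_p) : \bar R := (\prod_(j < p) (\1_(C i j) (u ord0 j))%:E)%E.
have mind i j : measurable_fun setT (EFin \o (\1_(C i j) : R -> R)).
  by apply/measurable_EFinP; exact: measurable_indic.
have mF i : measurable_fun setT (F i).
  rewrite /F; elim: (index_enum _) => [|j s IHs].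
    by under eq_fun do rewrite big_nil; exact: measurable_cst.
  under eq_fun do rewrite big_cons; apply: emeasurable_funM => //.
  exact: (measurableT_comp (mind i j) (measurable_entry ord0 j)).
have F0 i u : (0 <= F i u)%E by apply: prode_ge0 => j _; rewrite lee_fin.
transitivity (\int[gauss_mx n p]_M (\prod_(i < n) F i (row i M)))%E.
  rewrite -[X in gauss_mx n p X]setIT -integral_indic//; last exact: measurable_mx_rect.
  apply: eq_integral => M _; rewrite indic_rect; apply: eq_bigr => i _.
  by apply: eq_bigr => j _; rewrite mxE.
rewrite iid_rows_prod//; apply: eq_bigr => i _.
rewrite ge0_integral_image_prob//.
transitivity (\int[gauss_col p]_g (\prod_(j < p) (\1_(C i j) (g j ord0))%:E))%E.
  by apply: eq_integral => g _; apply: eq_bigr => j _; rewrite mxE.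
rewrite (@gauss_col_prod p (fun j x => (\1_(C i j) x)%:E))//; last by move=> j; exact: mind.
apply: eq_bigr => j _; rewrite integral_indic//; first by congr (normal_prob _ _ _); rewrite setIT.
exact: mC.
Qed.

Lemma measurable_expR_quadratic p (a : R) (w : 'cV[R]_p) :
  measurable_fun setT (fun g : 'cV[R]_p => expR (a * sqnorm g + (w^T *m g) ord0 ord0)).
Proof.
apply: measurableT_comp => //; apply: measurable_funD.
  by apply: measurable_funM => //; exact: measurable_sqnorm.
apply: (measurableT_comp (measurable_entry _ _)).
exact: measurable_mulmx.
Qed.

Lemma gauss_col_expR p (s : R) (w : 'cV[R]_p) : 0 < s ->
  (\int[gauss_col p]_g
     (expR ((1 - s ^- 2) / 2 * sqnorm g + (w^T *m g) ord0 ord0))%:E =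
   (s ^+ p * expR (sqnorm w * s ^+ 2 / 2))%:E)%E.
Proof.
move=> s0; set a := (1 - _) / 2.
transitivity (\int[gauss_col p]_g
    (\prod_(i < p) (expR (a * (g i ord0) ^+ 2 + w i ord0 * g i ord0))%:E))%E.
  apply: eq_integral => g _; rewrite prodEFin -expR_sum; congr (expR _)%:E.
  rewrite big_split/= -mulr_sumr mxE; congr (_ + _).
  by apply: eq_bigr => i _; rewrite mxE.
rewrite (@gauss_col_prod p (fun i x => (expR (a * x ^+ 2 + w i ord0 * x))%:E))//; last first.
  move=> i; apply/measurable_EFinP; apply: measurableT_comp => //.
  apply: measurable_funD; last exact: measurable_funM.
  by apply: measurable_funM => //; exact: measurable_funX.
under eq_bigr do rewrite integral_normal_prob_expR//.
rewrite prodEFin big_split/= prodr_const card_ord -expR_sum.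
by rewrite /sqnorm !mulr_suml.
Qed.

End Gaussian.

(** * Minimum-norm interpolation and the risk gap *)

Section LinearAlgebra.
Context {R : realType}.

Definition dot n (u v : 'cV[R]_n) : R := (u^T *m v) ord0 ord0.

Lemma dotE n (u v : 'cV[R]_n) : dot u v = \sum_i u i ord0 * v i ord0.
Proof. by rewrite /dot mxE; apply: eq_bigr => i _; rewrite mxE. Qed.

Lemma sqnorm_dot n (u : 'cV[R]_n) : sqnorm u = dot u u.
Proof. by rewrite dotE; apply: eq_bigr => i _; rewrite expr2. Qed.

Lemma dotC n (u v : 'cV[R]_n) : dot u v = dot v u.
Proof. by rewrite !dotE; apply: eq_bigr => i _; rewrite mulrC. Qed.

Lemma dotDl n (u v w : 'cV[R]_n) : dot (u + v) w = dot u w + dot v w.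
Proof. by rewrite /dot linearD mulmxDl mxE. Qed.

Lemma dotNl n (u w : 'cV[R]_n) : dot (- u) w = - dot u w.
Proof. by rewrite /dot linearN mulNmx mxE. Qed.

Lemma dotZl n c (u w : 'cV[R]_n) : dot (c *: u) w = c * dot u w.
Proof. by rewrite /dot linearZ -scalemxAl mxE. Qed.

Lemma dotDr n (u v w : 'cV[R]_n) : dot w (u + v) = dot w u + dot w v.
Proof. by rewrite dotC dotDl !(dotC w). Qed.

Lemma dotNr n (u w : 'cV[R]_n) : dot w (- u) = - dot w u.
Proof. by rewrite dotC dotNl dotC. Qed.

Lemma dotZr n c (u w : 'cV[R]_n) : dot w (c *: u) = c * dot w u.
Proof. by rewrite dotC dotZl dotC. Qed.

Lemma dot0r n (u : 'cV[R]_n) : dot u 0 = 0.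
Proof. by rewrite /dot mulmx0 mxE. Qed.

Lemma dot_mull m n (A : 'M[R]_(m, n)) u v : dot (A *m u) v = dot u (A^T *m v).
Proof. by rewrite /dot trmx_mul mulmxA. Qed.

Lemma dot_mulr m n (A : 'M[R]_(m, n)) u v : dot u (A *m v) = dot (A^T *m u) v.
Proof. by rewrite dot_mull trmxK. Qed.

Lemma sqnorm_ge0 n (u : 'cV[R]_n) : 0 <= sqnorm u.
Proof. by apply: sumr_ge0 => i _; exact: sqr_ge0. Qed.

Lemma sqnorm_eq0 n (u : 'cV[R]_n) : (sqnorm u == 0) = (u == 0).
Proof.
apply/eqP/eqP => [u0|->]; last by rewrite /sqnorm big1// => i _; rewrite mxE expr0n.
apply/colP => i; apply/eqP; rewrite mxE -sqrf_eq0.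
by move/eqP: u0; rewrite psumr_eq0 => [/allP/(_ i (mem_index_enum _))|j _];
  rewrite ?sqr_ge0.
Qed.

Lemma sqnorm_gt0 n (u : 'cV[R]_n) : (0 < sqnorm u) = (u != 0).
Proof. by rewrite lt0r sqnorm_eq0 sqnorm_ge0 andbT. Qed.

Lemma sqnormZ n c (u : 'cV[R]_n) : sqnorm (c *: u) = c ^+ 2 * sqnorm u.
Proof. by rewrite !sqnorm_dot dotZl dotZr mulrA expr2. Qed.

Lemma sqnormD n (u v : 'cV[R]_n) : sqnorm (u + v) = sqnorm u + sqnorm v + 2 * dot u v.
Proof. by rewrite !sqnorm_dot dotDl !dotDr (dotC v u); ring. Qed.

Lemma sqnormN n (u : 'cV[R]_n) : sqnorm (- u) = sqnorm u.
Proof. by rewrite !sqnorm_dot dotNl dotNr opprK. Qed.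

Lemma dot_sqr_le n (u v : 'cV[R]_n) : dot u v ^+ 2 <= sqnorm u * sqnorm v.
Proof.
have [->|v0] := eqVneq v 0.
  by rewrite /dot mulmx0 mxE expr0n mulr_ge0// sqnorm_ge0.
have := sqnorm_ge0 (sqnorm v *: u - dot u v *: v).
rewrite sqnormD sqnormN !sqnormZ dotNr dotZl dotZr => h.
have {}h : 0 <= sqnorm v * (sqnorm u * sqnorm v - dot u v ^+ 2) by nra.
by move: h; rewrite pmulr_rge0 ?sqnorm_gt0// subr_ge0.
Qed.

Lemma dot_le_of_sqnorm n (u v : 'cV[R]_n) a b : 0 <= a -> 0 <= b ->
  sqnorm u <= a ^+ 2 -> sqnorm v <= b ^+ 2 -> dot u v <= a * b.
Proof.
move=> a0 b0 ua vb; apply: (le_trans (ler_norm _)).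
rewrite -(ler_pXn2r (ltn0Sn 1)) ?nnegrE ?mulr_ge0// real_normK ?num_real// exprMn.
apply: (le_trans (dot_sqr_le u v)).
by apply: ler_pM; rewrite ?sqnorm_ge0.
Qed.

(** Expanding |c v - A^T A v|^2 >= 0 gives c (c |v|^2 - |A v|^2) >= 0; the factor c can be cancelled
    unless c = 0, in which case A v = 0. *)
Lemma sqnorm_le_isometry m n (A : 'M[R]_(m, n)) (c : R) (v : 'cV[R]_n) :
  0 <= c -> A *m A^T = c%:M -> sqnorm (A *m v) <= c * sqnorm v.
Proof.
move=> c0 Ac.
have AAv : sqnorm (A^T *m (A *m v)) = c * sqnorm (A *m v).
  by rewrite sqnorm_dot dot_mull trmxK mulmxA Ac mul_scalar_mx dotZr -sqnorm_dot.
have [c00|cn0] := eqVneq c 0.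
  move: AAv; rewrite c00 !mul0r => /eqP; rewrite sqnorm_eq0 => /eqP AAv0.
  by rewrite sqnorm_dot dot_mull AAv0 /dot mulmx0 mxE.
have cp : 0 < c by rewrite lt0r cn0.
have := sqnorm_ge0 (c *: v - A^T *m (A *m v)).
rewrite sqnormD sqnormN AAv sqnormZ dotNr dotZl dot_mulr trmxK -sqnorm_dot => h.
have {}h : 0 <= c * (c * sqnorm v - sqnorm (A *m v)) by nra.
by move: h; rewrite pmulr_rge0// subr_ge0.
Qed.

Lemma sqnorm_isometry m n (A : 'M[R]_(m, n)) v : A^T *m A = 1%:M ->
  sqnorm (A *m v) = sqnorm v.
Proof. by move=> AA; rewrite !sqnorm_dot dot_mull mulmxA AA mul1mx. Qed.

Lemma gram_unitmx n p (X : 'M[R]_(n, p)) :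
  (forall a : 'rV_n, a *m X = 0 -> a = 0) -> X *m X^T \in unitmx.
Proof.
move=> X0; rewrite -row_free_unit; apply: inj_row_free => a aXX0.
apply: X0; apply: trmx_inj; rewrite trmx0; apply/eqP; rewrite -sqnorm_eq0.
by rewrite sqnorm_dot /dot trmxK trmx_mul mulmxA -(mulmxA a) aXX0 mul0mx mxE.
Qed.

Lemma gram_unitmx_inj n p (X : 'M[R]_(n, p)) (a : 'rV_n) :
  X *m X^T \in unitmx -> a *m X = 0 -> a = 0.
Proof.
by move=> Xu aX; rewrite -[a]mulmx1 -(mulmxV Xu) !mulmxA aX !mul0mx.
Qed.

Lemma mulmx_minnorm n p (X : 'M[R]_(n, p)) y : X *m X^T \in unitmx ->
  X *m minnorm X y = y.
Proof. by move=> Xu; rewrite /minnorm !mulmxA mulmxV// mul1mx. Qed.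

(** Pythagoras: the minimum-norm solution lies in the row space of X, and its difference from any
    other solution lies in the kernel. *)
Lemma minnorm_le n p (X : 'M[R]_(n, p)) y b : X *m X^T \in unitmx ->
  X *m b = y -> sqnorm (minnorm X y) <= sqnorm b.
Proof.
move=> Xu Xb; set e := minnorm X y.
have -> : b = e + (b - e) by rewrite addrC subrK.
rewrite sqnormD -[leLHS]addr0 -addrA lerD2l.
rewrite [X in _ + 2 * X](_ : _ = 0) ?mulr0 ?addr0 ?sqnorm_ge0//.
rewrite {1}/e /minnorm -mulmxA dot_mull trmxK mulmxBr Xb mulmx_minnorm//.
by rewrite subrr /dot mulmx0 mxE.
Qed.

Definition rowproj n p (X : 'M[R]_(n, p)) : 'M[R]_p := X^T *m invmx (X *m X^T) *m X.

Lemma rowproj_minnorm n p (X : 'M[R]_(n, p)) y : X *m X^T \in unitmx ->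
  rowproj X *m minnorm X y = minnorm X y.
Proof. by move=> Xu; rewrite /rowproj -mulmxA mulmx_minnorm. Qed.

Lemma trmx_rowproj n p (X : 'M[R]_(n, p)) : (rowproj X)^T = rowproj X.
Proof. by rewrite /rowproj !trmx_mul trmxK trmx_inv trmx_mul trmxK mulmxA. Qed.

Lemma rowproj_idem n p (X : 'M[R]_(n, p)) : X *m X^T \in unitmx ->
  rowproj X *m rowproj X = rowproj X.
Proof.
move=> Xu; rewrite /rowproj -!mulmxA; congr (_ *m _).
by rewrite !mulmxA -(mulmxA _ X) mulVmx// mul1mx.
Qed.

(** The rotation bounds concern a fixed matrix with orthonormal rows; this brings the projection
    into that form. With X = L C and C C^T = 1 the factor L is invertible and cancels, leaving
    [rowproj X] = C^T C. *)
Lemma gram_schmidt n p (X : 'M[R]_(n, p)) : X *m X^T \in unitmx ->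
  exists C : 'M[R]_(n, p), C *m C^T = 1%:M /\
    forall v : 'cV[R]_p, sqnorm (rowproj X *m v) = sqnorm (C *m v).
Proof.
move=> Xu; suff [L [C [XE CC]]] : exists (L : 'M[R]_n) (C : 'M[R]_(n, p)),
    X = L *m C /\ C *m C^T = 1%:M.
  exists C; split=> // v.
  have XX : X *m X^T = L *m L^T by rewrite XE trmx_mul mulmxA -(mulmxA L) CC mulmx1.
  have Lu : L \in unitmx by move: Xu; rewrite XX unitmx_mul => /andP[].
  have LL1 : L^T *m invmx (L *m L^T) *m L = 1%:M.
    apply: (can_inj (mulKmx Lu)); rewrite mulmx1 !mulmxA mulmxV ?mul1mx//.
    by rewrite -XX.
  have -> : rowproj X = C^T *m C.
    have -> : rowproj X = C^T *m (L^T *m invmx (L *m L^T) *m L) *m C.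
      by rewrite /rowproj XX XE trmx_mul !mulmxA.
    by rewrite LL1 mulmx1.
  by rewrite -mulmxA sqnorm_isometry// trmxK.
have {Xu} : forall a : 'rV_n, a *m X = 0 -> a = 0.
  by move=> a; exact: gram_unitmx_inj.
elim: n X => [|n IH] X X0.
  by exists 0, 0; split; apply/matrixP => -[].
have [u [V XE]] : exists (u : 'rV[R]_p) (V : 'M[R]_(n, p)),
    X = col_mx u V :> 'M[R]_(1 + n, p).
  by exists (usubmx (X : 'M[R]_(1 + n, p))), (dsubmx (X : 'M[R]_(1 + n, p)));
    rewrite vsubmxK.
have {}X0 (b : 'rV_1) (a : 'rV_n) : b *m u + a *m V = 0 -> b = 0 /\ a = 0.
  move=> ba; apply: eq_row_mx; rewrite row_mx0; apply: X0.
  by rewrite XE; exact: (etrans (mul_row_col _ _ _ _) ba).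
have V0 (a : 'rV_n) : a *m V = 0 -> a = 0.
  by move=> aV; have [|//] := X0 0 a; rewrite mul0mx add0r.
have [L [C [VE CC]]] := IH V V0.
have Lu : L \in unitmx.
  have : V *m V^T \in unitmx by exact: gram_unitmx.
  by rewrite VE trmx_mul mulmxA -(mulmxA L) CC mulmx1 unitmx_mul => /andP[].
(* The new row is on top: u is its component (u C^T) C plus r, which makes L' block upper
   triangular. Independence of the rows forces r to be nonzero, so it can be normalized. *)
pose r := u - u *m C^T *m C.
have rC : r *m C^T = 0.
  by rewrite /r mulmxBl -(mulmxA _ C) CC mulmx1 subrr.
have r0 : r != 0.
  apply/eqP => /eqP; rewrite subr_eq0 => /eqP uE.
  have [|/matrixP/(_ ord0 ord0)] := X0 1%:M (- (u *m C^T *m invmx L)).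
    by rewrite mul1mx mulNmx {1}VE !mulmxA mulmxKV// -uE subrr.
  by rewrite !mxE eqxx => /eqP; rewrite oner_eq0.
pose c := Num.sqrt (sqnorm r^T).
have c0 : c != 0 by rewrite gt_eqF// sqrtr_gt0 sqnorm_gt0 trmx_eq0.
have rr : r *m r^T = (c ^+ 2)%:M.
  by rewrite sqr_sqrtr ?sqnorm_ge0// sqnorm_dot /dot trmxK; exact: mx11_scalar.
pose L' : 'M[R]_(1 + n) := block_mx c%:M (u *m C^T) 0 L.
pose C' : 'M[R]_(1 + n, p) := col_mx (c^-1 *: r) C.
have XE' : col_mx u V = L' *m C'.
  rewrite mul_block_col mul0mx add0r -VE mul_scalar_mx scalerA divff// scale1r.
  by rewrite /r subrK.
have CC' : C' *m C'^T = 1%:M.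
  rewrite tr_col_mx mul_col_row CC linearZ/= -!scalemxAl -!scalemxAr rr rC.
  rewrite -[C *m r^T]trmxK trmx_mul trmxK rC trmx0 !scaler0 scalerA scale_scalar_mx.
  rewrite -invfM -expr2 mulVf ?expf_neq0//.
  by rewrite -(scalar_mx_block 1 n 1).
by exists L', C'; split; [rewrite XE|].
Qed.

(** The reflection along w = u - v works because equal norms give |w|^2 = 2 w . u. *)
Lemma householder n (u v : 'cV[R]_n) : sqnorm u = sqnorm v ->
  exists Q : 'M[R]_n, Q *m Q^T = 1%:M /\ Q *m u = v.
Proof.
move=> uv; have [->|w0] := eqVneq u v; first by exists 1%:M; rewrite trmx1 !mul1mx.
pose w := u - v; have {}w0 : w != 0 by rewrite subr_eq0.
have sw0 : sqnorm w != 0 by rewrite sqnorm_eq0.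
pose Q : 'M[R]_n := 1%:M - (2 / sqnorm w) *: (w *m w^T).
have wwE (x : 'cV[R]_n) : w *m w^T *m x = dot w x *: w.
  by rewrite -mulmxA (mx11_scalar (w^T *m x)) mul_mx_scalar.
have QT : Q^T = Q by rewrite /Q linearB/= trmx1 linearZ/= trmx_mul trmxK.
exists Q; split.
  rewrite QT {1}/Q mulmxBl mul1mx /Q mulmxBr mulmx1 -!scalemxAl -scalemxAr.
  rewrite mulmxA wwE -sqnorm_dot -scalemxAl !scalerA divfK//.
  set M := w *m w^T; set a := 2 / sqnorm w.
  rewrite -addrA -[RHS]addr0; congr (_ + _).
  by rewrite (_ : a * 2 = a + a) ?scalerDl ?opprB ?addrK ?addNr//; ring.
rewrite /Q mulmxBl mul1mx -scalemxAl wwE scalerA.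
have -> : 2 / sqnorm w * dot w u = 1.
  suff sE : sqnorm w = 2 * dot w u by rewrite mulrAC -sE divff.
  rewrite /w sqnormD sqnormN -uv dotDl dotNl -sqnorm_dot dotNr (dotC v).
  by ring.
by rewrite scale1r /w opprB addrC subrK.
Qed.

(** * The risk gap as a deterministic inequality *)

Section RiskGap.
Variables (n p d : nat) (W : 'M[R]_(p, d)) (theta : 'cV[R]_d) (s2 q : R).
Variables (X : 'M[R]_(n, p)) (y : 'cV[R]_n) (O : 'M[R]_p).
Hypothesis s2_ge1 : 1 <= s2.
Hypothesis q_range : 0 <= q <= 4^-1.
Hypothesis WW : W^T *m W = s2%:M.
Hypothesis Xu : X *m X^T \in unitmx.
Hypothesis OO : O *m O^T = 1%:M.
Let e := minnorm X y.
Hypothesis e_le : s2 * sqnorm e <= 4 * sqnorm theta.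
Hypothesis WOe_le : sqnorm (W^T *m O *m e) <= s2 * (4 * q ^+ 2 * sqnorm e).
Hypothesis POe_le : sqnorm (rowproj X *m O^T *m e) <= 4 * q ^+ 2 * sqnorm e.

Let OTO : O^T *m O = 1%:M.
Proof. exact: mulmx1C. Qed.

Let delta := O *m e - O *m (rowproj X *m O^T *m e).

Let beta_BAE : beta_BA X (X *m O^T) y = e + delta.
Proof.
rewrite /beta_BA /colproj /minnorm !trmx_mul !trmxK -/e.
have -> : X *m O^T *m (O *m X^T) = X *m X^T by rewrite mulmxA -(mulmxA X) OTO mulmx1.
by rewrite /delta /e /minnorm /rowproj !mulmxA addrA.
Qed.

Let risk_gapE : riskA W theta (e + delta) - riskA W theta e =
  sqnorm e - sqnorm (rowproj X *m O^T *m e) + sqnorm (W^T *m delta)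
  + 2 * dot (W^T *m delta) (W^T *m e - theta).
Proof.
have s0 : s2 + 1 != 0 by rewrite gt_eqF// ltr_wpDl// (le_trans _ s2_ge1).
have betaE : beta_star W theta = (s2 + 1)^-1 *: (W *m theta).
  rewrite /beta_star WW -raddfD/= invmx_scalar mul_mx_scalar -scalemxAl.
  by [].
have SigE (b : 'cV[R]_p) : (b^T *m Sigma W *m b) ord0 ord0 =
    sqnorm b + sqnorm (W^T *m b).
  rewrite /Sigma mulmxDr mulmx1 mulmxDl mxE addrC -[X in X + _]/(dot b b).
  by rewrite sqnorm_dot sqnorm_dot [in RHS]dot_mull trmxK /dot !mulmxA.
rewrite /riskA !SigE; set b := beta_star W theta.
set x := e - b; have -> : e + delta - b = x + delta by rewrite addrAC.
rewrite mulmxDr (sqnormD x delta) (sqnormD (W^T *m x) (W^T *m delta)).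
have Wx : W^T *m x = W^T *m e - (s2 / (s2 + 1)) *: theta.
  rewrite /x mulmxBr /b betaE -scalemxAr (mulmxA W^T W) WW mul_scalar_mx scalerA.
  by rewrite (mulrC s2).
have xd : dot x delta = dot e delta - (s2 + 1)^-1 * dot (W^T *m delta) theta.
  rewrite /x dotDl dotNl /b betaE dotZl; congr (_ - _ * _).
  by rewrite dot_mull dotC.
(* The left side is |beta_BA|^2 - |e|^2. In beta_BA, the summand O e lies in the row space of X_B
   and e - O P O^T e is orthogonal to it; algebraically, the terms e . P O^T e cancel. *)
have dd : sqnorm delta + 2 * dot e delta =
    sqnorm e - sqnorm (rowproj X *m O^T *m e).
  set f := rowproj X *m O^T *m e.
  have fE : f = rowproj X *m (O^T *m e) by rewrite mulmxA.
  have eOf : dot e (O *m f) = sqnorm f.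
    rewrite dot_mulr fE [in RHS]sqnorm_dot [in RHS]dot_mull trmx_rowproj.
    by rewrite (mulmxA (rowproj X) (rowproj X)) rowproj_idem.
  have eOe : dot (O *m e) (O *m f) = dot e f by rewrite dot_mull mulmxA OTO mul1mx.
  have ef : dot e f = dot e (O^T *m e).
    by rewrite fE dot_mulr trmx_rowproj rowproj_minnorm.
  have eOTe : dot e (O *m e) = dot e (O^T *m e) by rewrite dot_mulr dotC.
  rewrite /delta sqnormD sqnormN !(sqnorm_isometry _ OTO) dotNr dotDr dotNr.
  by rewrite -/f eOe eOf ef eOTe; ring.
(* The multiples of theta coming from x . delta and from W^T x have coefficients 1 / (s2 + 1) and s2
   / (s2 + 1), which add up to 1. *)
rewrite xd Wx (dotC _ (W^T *m delta)) !(dotDr (W^T *m e)) (dotNr theta) (dotNr (_ *: theta)) dotZr.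
move: dd s0; set t := dot _ theta; set u := dot _ (W^T *m e).
set De := dot e delta; set sf := sqnorm (rowproj _ *m _ *m _) => dd s0.
rewrite -dd.
by field.
Qed.

Lemma risk_gap_le :
  riskA W theta (beta_BA X (X *m O^T) y) - riskA W theta e <=
  (66 * q + 12 / s2) * sqnorm theta.
Proof.
have /andP[q0 q4] := q_range; have s0 : 0 < s2 by exact: lt_le_trans s2_ge1.
rewrite beta_BAE risk_gapE.
have t0 : 0 <= sqnorm theta by exact: sqnorm_ge0.
pose r := Num.sqrt (sqnorm theta).
have r0 : 0 <= r by exact: sqrtr_ge0.
have rE : sqnorm theta = r ^+ 2 by rewrite sqr_sqrtr.
have rle : sqnorm theta <= r ^+ 2 by rewrite -rE.
have e_bound : sqnorm e <= 4 / s2 * r ^+ 2.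
  by rewrite -rE mulrAC ler_pdivlMr// mulrC.
have sq2 (k : nat) (u v : 'cV[R]_k) a : sqnorm u <= a -> sqnorm v <= a ->
    sqnorm (u - v) <= 4 * a.
  move=> ua va; have := sqnorm_ge0 (u + v).
  by rewrite !sqnormD sqnormN dotNr; lra.
have Wcontr (v : 'cV[R]_p) : sqnorm (W^T *m v) <= s2 * sqnorm v.
  by apply: sqnorm_le_isometry; rewrite ?trmxK ?ltW.
have e4 : s2 * sqnorm e <= 4 * r ^+ 2 by rewrite -rE.
have Wd : sqnorm (W^T *m delta) <= (8 * q * r) ^+ 2.
  have : sqnorm (W^T *m delta) <= 4 * (s2 * (4 * q ^+ 2 * sqnorm e)).
    rewrite /delta mulmxBr; apply: sq2; first by rewrite mulmxA.
    apply: (le_trans (Wcontr _)); rewrite ler_pM2l// sqnorm_isometry//.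
  have : q ^+ 2 * (s2 * sqnorm e) <= q ^+ 2 * (4 * r ^+ 2).
    by rewrite ler_wpM2l// sqr_ge0.
  by rewrite !exprMn; lra.
have Wt : sqnorm (W^T *m e - theta) <= (3 * r) ^+ 2.
  have We : sqnorm (- (W^T *m e)) <= (2 * r) ^+ 2.
    by rewrite sqnormN exprMn; have := le_trans (Wcontr e) e4; lra.
  have := dot_le_of_sqnorm (mulr_ge0 (ler0n R 2) r0) r0 We rle.
  move: We; rewrite sqnormN dotNl sqnormD sqnormN dotNr rE !exprMn; lra.
(* The budget, in units of |theta|^2: |e|^2 costs 4 / s2, the cross term 2 * 8 q * 3 = 48 q, and
   |W^T delta|^2 costs 64 q^2 <= 16 q since q <= 1/4. *)
have := dot_le_of_sqnorm (mulr_ge0 (mulr_ge0 (ler0n R 8) q0) r0)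
  (mulr_ge0 (ler0n R 3) r0) Wd Wt.
have := sqnorm_ge0 (rowproj X *m O^T *m e).
have : q * q * r ^+ 2 <= 4^-1 * q * r ^+ 2.
  by rewrite ler_wpM2r ?sqr_ge0// ler_wpM2r.
have : 0 <= q * r ^+ 2 by rewrite mulr_ge0// sqr_ge0.
have : 0 <= s2^-1 * r ^+ 2 by rewrite mulr_ge0 ?sqr_ge0// invr_ge0 ltW.
move: Wd e_bound; rewrite rE.
lra.
Qed.

End RiskGap.

End LinearAlgebra.

(** * Gaussian concentration *)

Section GaussianTails.
Context {R : realType}.

(** Cutting the exponent of 2 <= exp (3/4) into ten parts makes 1 + x <= exp x sharp enough. The
    value 3/8 is the origin of the final rate: -1/2 + 3/8 = -1/8. *)
Lemma sqrt2_le_expR : Num.sqrt 2 <= expR (3 / 8) :> R.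
Proof.
rewrite -(ler_pXn2r (ltn0Sn 1)) ?nnegrE ?sqrtr_ge0 ?expR_ge0// sqr_sqrtr//.
rewrite -expRM_natl (_ : 2%:R * (3 / 8) = 10%:R * (3 / 40) :> R); last by field.
rewrite expRM_natl; apply: (@le_trans _ _ ((1 + 3 / 40) ^+ 10)); first by lra.
by apply: lerXn2r; rewrite ?nnegrE ?expR_ge0 ?expR_ge1Dx//; lra.
Qed.

(** Again 1 + x <= exp x, now on twenty parts; 1/3 is a rational just below (log 2) / 2. *)
Lemma invr_sqrt2_le_expR : (Num.sqrt 2)^-1 <= expR (- (1 / 3)) :> R.
Proof.
rewrite -(ler_pXn2r (ltn0Sn 1)) ?nnegrE ?invr_ge0 ?sqrtr_ge0 ?expR_ge0//.
rewrite exprVn sqr_sqrtr// -expRM_natl.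
rewrite (_ : 2%:R * - (1 / 3) = 20%:R * (- (1 / 30)) :> R); last by field.
rewrite expRM_natl; apply: (@le_trans _ _ ((1 - 1 / 30) ^+ 20)); first by lra.
by apply: lerXn2r; rewrite ?nnegrE ?expR_ge0 ?expR_ge1Dx//; lra.
Qed.

Lemma markov_expR d (T : measurableType d) (mu : probability T R) (f : T -> R) a :
  measurable_fun setT f ->
  (mu [set x | (a <= f x)%R] <= (expR (- a))%:E * \int[mu]_x (expR (f x))%:E)%E.
Proof.
move=> mf; have mA : measurable [set x | a <= f x] by exact: measurable_set_ler.
have me : measurable_fun setT (fun x => (expR (f x))%:E).
  by apply/measurable_EFinP; exact: measurableT_comp.
rewrite -ge0_integralZl ?lee_fin ?expR_ge0//.
rewrite -[X in mu X]setIT -integral_indic//; apply: ge0_le_integral => //.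
- by apply/measurable_EFinP; exact: measurable_indic.
- by apply: emeasurable_funM.
- move=> x _; rewrite -EFinM lee_fin indicE.
  have [|_] := boolP (x \in _); last by rewrite mulr_ge0 ?expR_ge0.
  by rewrite inE/= => ax; rewrite -expRD -[leLHS]expR0 ler_expR addrC subr_ge0.
Qed.

(* Hubbard-Stratonovich: [expR (l ^+ 2 / 2 * sqnorm x)] is the Laplace transform
   at [l *: x] of an independent standard Gaussian vector. *)
Lemma gauss_col_expR_contraction m p (B : 'M[R]_(m, p)) (s l : R) :
  0 < s -> l ^+ 2 * s ^+ 2 = 2^-1 ->
  (forall h : 'cV_m, sqnorm (B^T *m h) <= sqnorm h) ->
  (\int[gauss_col p]_v
    (expR ((1 - s ^- 2) / 2 * sqnorm v + l ^+ 2 / 2 * sqnorm (B *m v)))%:E <=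
   (s ^+ p * Num.sqrt 2 ^+ m)%:E)%E.
Proof.
move=> s0 ls BT; set a := (1 - _) / 2.
pose F (z : 'cV[R]_p * 'cV[R]_m) :=
  (expR (a * sqnorm z.1 + ((l *: (B *m z.1))^T *m z.2) ord0 ord0))%:E.
have m1 : measurable_fun setT (fun z : 'cV[R]_p * 'cV[R]_m => z.1).
  exact: measurable_fst.
have m2 : measurable_fun setT (fun z : 'cV[R]_p * 'cV[R]_m => z.2).
  exact: measurable_snd.
have mF : measurable_fun setT F.
  apply/measurable_EFinP; apply: measurableT_comp => //; apply: measurable_funD.
    by apply: measurable_funM => //; exact: measurable_sqnorm.
  apply: (measurableT_comp (measurable_entry _ _)); apply: measurable_mulmx => //.
  by apply: measurable_trmx; apply: measurable_scalemx => //; exact: measurable_mulmx.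
have F0 z : (0 <= F z)%E by rewrite lee_fin expR_ge0.
have E1 v : (\int[gauss_col m]_h F (v, h) =
    (expR (a * sqnorm v + l ^+ 2 / 2 * sqnorm (B *m v)))%:E)%E.
  have := gauss_col_expR (l *: (B *m v)) (@ltr01 R).
  rewrite expr1n invr1 subrr mul0r expr1n mul1r mulr1 sqnormZ => H.
  rewrite expRD EFinM (_ : l ^+ 2 / 2 * _ = l ^+ 2 * sqnorm (B *m v) / 2); last by ring.
  rewrite -H -ge0_integralZl//.
  - by apply: eq_integral => h _; rewrite mul0r add0r -EFinM -expRD.
  - by apply/measurable_EFinP; exact: (@measurable_expR_quadratic _ _ 0).
rewrite -(eq_integral _ _ (fun v _ => E1 v)) -fubini_tonelli1// fubini_tonelli2//.
(* Integrating over v first leaves the exponent l^2 s^2 |B^T h|^2 / 2 <= |h|^2 / 4, which is the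
   quadratic coefficient belonging to the parameter sqrt 2; each coordinate of h then contributes a
   factor sqrt 2. *)
have E2 h : (\int[gauss_col p]_v F (v, h) <=
    (s ^+ p)%:E * (expR ((1 - Num.sqrt 2 ^- 2) / 2 * sqnorm h
      + ((0 : 'cV_m)^T *m h) ord0 ord0))%:E)%E.
  have := gauss_col_expR (l *: (B^T *m h)) s0.
  rewrite (eq_integral (fun v => F (v, h))) => [->|v _]; last first.
    congr (expR (_ + _))%:E; rewrite -/(dot _ _) -[RHS]/(dot _ _).
    by rewrite !dotZl (dot_mull B) dotC.
  rewrite -EFinM lee_fin; apply: ler_wpM2l; rewrite ?exprn_ge0 ?(ltW s0)// ler_expR.
  rewrite trmx0 mul0mx mxE addr0 sqnormZ sqr_sqrtr//.
  rewrite (_ : l ^+ 2 * _ * _ / 2 = l ^+ 2 * s ^+ 2 * sqnorm (B^T *m h) / 2); last by ring.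
  by rewrite ls; have := BT h; lra.
apply: (@le_trans _ _ (\int[gauss_col m]_h ((s ^+ p)%:E *
    (expR ((1 - Num.sqrt 2 ^- 2) / 2 * sqnorm h
      + ((0 : 'cV_m)^T *m h) ord0 ord0))%:E))%E).
  apply: ge0_le_integral => //.
  - by move=> h _; apply: integral_ge0 => v _; exact: F0.
  - exact: measurable_fun_fubini_tonelli_G.
  - apply: emeasurable_funM => //; apply/measurable_EFinP.
    exact: measurable_expR_quadratic.
  - by move=> h _; exact: E2.
rewrite ge0_integralZl ?lee_fin ?exprn_ge0 ?(ltW s0)//; last first.
  by apply/measurable_EFinP; exact: measurable_expR_quadratic.
rewrite gauss_col_expR ?sqrtr_gt0// -EFinM /sqnorm big1 => [|i _].
  by rewrite !mul0r expR0 mulr1.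
by rewrite mxE expr0n.
Qed.

(** Chernoff bound with exponent - |v|^2 / 2, that is s^2 = 1/2: the mean 2^(-p/2) is at most exp (-
    p/3), and the threshold costs exp (p/4). *)
Lemma gauss_col_norm_lower p :
  (gauss_col p [set v | (sqnorm v <= p%:R / 2 :> R)%R] <= (expR (- (p%:R / 12)))%:E)%E.
Proof.
have := @gauss_col_expR R p (Num.sqrt 2)^-1 0.
rewrite invr_gt0 sqrtr_gt0 => /(_ (ltr0Sn _ 1)).
rewrite exprVn invrK sqr_sqrtr//.
rewrite [sqnorm 0]big1 ?mul0r ?expR0 ?mulr1; last by move=> i _; rewrite mxE expr0n.
pose f (v : 'cV[R]_p) := (1 - 2) / 2 * sqnorm v + ((0 : 'cV_p)^T *m v) ord0 ord0.
move=> H.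
have mf : measurable_fun setT f.
  apply: measurable_funD; first by apply: measurable_funM => //; exact: measurable_sqnorm.
  by apply: (measurableT_comp (measurable_entry _ _)); exact: measurable_mulmx.
have := markov_expR (gauss_col p) (- (p%:R / 4)) mf.
rewrite [X in (_ <= _ * X)%E]H -EFinM opprK => le1.
have -> : [set v | sqnorm v <= p%:R / 2 :> R] = [set v | - (p%:R / 4) <= f v].
  apply/seteqP; split=> v /=; rewrite /f trmx0 mul0mx mxE; lra.
apply: (le_trans le1); rewrite lee_fin.
have -> : - (p%:R / 12) = p%:R / 4 + p%:R * - (1 / 3) :> R by field.
rewrite expRD; apply: ler_wpM2l; first exact: expR_ge0.
rewrite expRM_natl.
by apply: lerXn2r; rewrite ?nnegrE ?expR_ge0 ?invr_ge0 ?sqrtr_ge0// invr_sqrt2_le_expR.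
Qed.

Lemma gauss_col_contraction_upper m p n (B : 'M[R]_(m, p)) : (m <= n)%N ->
  (forall h : 'cV_m, sqnorm (B^T *m h) <= sqnorm h) ->
  (gauss_col p [set v | (2 * n%:R <= sqnorm (B *m v))%R] <= (expR (- (n%:R / 8)))%:E)%E.
Proof.
move=> mn BT.
have s2 : (Num.sqrt 2)^-1 ^+ 2 * 1 ^+ 2 = 2^-1 :> R.
  by rewrite exprVn sqr_sqrtr// expr1n mulr1.
have := gauss_col_expR_contraction (@ltr01 R) s2 BT.
rewrite expr1n invr1 subrr mul0r expr1n mul1r exprVn sqr_sqrtr//.
pose f (v : 'cV[R]_p) := 0 * sqnorm v + 2^-1 / 2 * sqnorm (B *m v).
move=> H.
have mf : measurable_fun setT f.
  by apply: measurable_funD; apply: measurable_funM => //; apply: measurable_sqnorm;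
    [exact: measurable_id|exact: measurable_mulmx].
have le1 := markov_expR (gauss_col p) (n%:R / 2) mf.
have -> : [set v | 2 * n%:R <= sqnorm (B *m v)] = [set v | n%:R / 2 <= f v].
  apply/seteqP; split=> v /=; rewrite /f; lra.
apply: (le_trans le1); apply: (le_trans (lee_wpmul2l _ H)).
  by rewrite lee_fin expR_ge0.
rewrite -EFinM lee_fin.
have -> : - (n%:R / 8) = - (n%:R / 2) + n%:R * (3 / 8) :> R by field.
rewrite expRD; apply: ler_wpM2l; first exact: expR_ge0.
apply: (@le_trans _ _ (expR (3 / 8) ^+ m)).
  by apply: lerXn2r; rewrite ?nnegrE ?expR_ge0 ?sqrtr_ge0// sqrt2_le_expR.
by rewrite -expRM_natl ler_expR ler_wpM2r// ler_nat.
Qed.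

(** Chernoff bound with exponent (|B v|^2 - |v|^2) / 2, whose mean is at most 2^(-(p - m)/2). The
    rate 2 n is strong enough to be paid once per row, because n exp (- 2 n) <= exp (- n). *)
Lemma gauss_col_residual_lower m p n (B : 'M[R]_(m, p)) :
  (m <= 2 * n)%N -> (17 * n <= p)%N ->
  (forall h : 'cV_m, sqnorm (B^T *m h) <= sqnorm h) ->
  (gauss_col p [set v | (sqnorm v - sqnorm (B *m v) <= p%:R / 4)%R] <=
    (expR (- (2 * n%:R)))%:E)%E.
Proof.
move=> mn np BT.
have s0 : 0 < (Num.sqrt 2)^-1 :> R by rewrite invr_gt0 sqrtr_gt0.
have s2 : 1 ^+ 2 * (Num.sqrt 2)^-1 ^+ 2 = 2^-1 :> R.
  by rewrite exprVn sqr_sqrtr// expr1n mul1r.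
have := gauss_col_expR_contraction s0 s2 BT.
rewrite expr1n exprVn sqr_sqrtr// invrK.
pose f (v : 'cV[R]_p) := (1 - 2) / 2 * sqnorm v + 1 / 2 * sqnorm (B *m v).
move=> H.
have mf : measurable_fun setT f.
  by apply: measurable_funD; apply: measurable_funM => //; apply: measurable_sqnorm;
    [exact: measurable_id|exact: measurable_mulmx].
have le1 := markov_expR (gauss_col p) (- (p%:R / 8)) mf.
have -> : [set v | sqnorm v - sqnorm (B *m v) <= p%:R / 4] = [set v | - (p%:R / 8) <= f v].
  apply/seteqP; split=> v /=; rewrite /f; lra.
apply: (le_trans le1); apply: (le_trans (lee_wpmul2l _ H)).
  by rewrite lee_fin expR_ge0.
rewrite -EFinM lee_fin opprK.
have mp : (m <= p)%N by lia.
rewrite -(subnK mp) exprD -mulrA -exprMn mulVf ?gt_eqF ?sqrtr_gt0// expr1n mulr1 subnK//.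
apply: (@le_trans _ _ (expR (p%:R / 8) * expR (- (1 / 3)) ^+ (p - m))).
  rewrite ler_wpM2l ?expR_ge0//; apply: lerXn2r.
  - by rewrite nnegrE invr_ge0 sqrtr_ge0.
  - by rewrite nnegrE expR_ge0.
  - exact: invr_sqrt2_le_expR.
rewrite -expRM_natl -expRD ler_expR natrB//.
have : m%:R <= 2 * n%:R :> R by rewrite -natrM ler_nat.
have : 17 * n%:R <= p%:R :> R by rewrite -natrM ler_nat.
by have : 0 <= n%:R :> R by []; lra.
Qed.

(** Since 4 n / p is the quotient of 2 n and p / 2, a large ratio forces a large numerator or a
    small denominator. *)
Lemma gauss_col_ratio_upper m p n (B : 'M[R]_(m, p)) : (0 < p)%N ->
  (m <= n)%N -> (17 * n <= p)%N ->
  (forall h : 'cV_m, sqnorm (B^T *m h) <= sqnorm h) ->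
  (gauss_col p [set v | (4 * (n%:R / p%:R) * sqnorm v <= sqnorm (B *m v))%R] <=
    (2 * expR (- (n%:R / 8)))%:E)%E.
Proof.
move=> p0 mn np BT.
have mB : measurable_fun setT (fun v : 'cV[R]_p => sqnorm (B *m v)).
  by apply: measurable_sqnorm; exact: measurable_mulmx.
have mI : measurable_fun setT (fun v : 'cV[R]_p => sqnorm v).
  by apply: measurable_sqnorm; exact: measurable_id.
pose A1 := [set v : 'cV[R]_p | sqnorm v <= p%:R / 2].
pose A2 := [set v : 'cV[R]_p | 2 * n%:R <= sqnorm (B *m v)].
have mA1 : measurable A1 by exact: measurable_set_ler.
have mA2 : measurable A2 by exact: measurable_set_ler.
apply: (@le_trans _ _ (gauss_col p (A1 `|` A2))).
  apply: le_measure; rewrite ?inE//.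
  - by apply: measurable_set_ler => //; exact: measurable_funM.
  - exact: measurableU.
  - move=> v /= hv; rewrite /A1 /A2 /=.
    have [|v2] := lerP (sqnorm v) (p%:R / 2); [by left|right].
    apply: (le_trans _ hv).
    have p0' : 0 < p%:R :> R by rewrite ltr0n.
    rewrite (_ : 2 * n%:R = 4 * (n%:R / p%:R) * (p%:R / 2)).
      by apply: ler_wpM2l; [rewrite mulr_ge0// divr_ge0|exact: ltW].
    by field; rewrite gt_eqF.
apply: (le_trans (measureU2 _ mA1 mA2)).
rewrite mulr_natl mulr2n EFinD; apply: leeD.
  apply: (le_trans (gauss_col_norm_lower p)); rewrite lee_fin ler_expR lerN2.
  have : 17 * n%:R <= p%:R :> R by rewrite -natrM ler_nat.
  by have : 0 <= n%:R :> R by []; lra.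
exact: gauss_col_contraction_upper.
Qed.

End GaussianTails.

(** * Norm of the interpolator *)

Section Extension.
Context {R : realType}.

Lemma iid_rowsS_le p (mu : probability 'rV[R]_p R) k (A : set 'M[R]_(k.+1, p))
    (G : 'rV[R]_p -> \bar R) :
  measurable A -> measurable_fun setT G ->
  (forall u, iid_rows mu k [set V | A (col_mx u V : 'M[R]_(1 + k, p))] <= G u)%E ->
  (iid_rows mu k.+1 A <= \int[mu]_u G u)%E.
Proof.
move=> mA mG AG; pose D := (fun z : 'rV[R]_p * 'M[R]_(k, p) =>
  (col_mx z.1 z.2 : 'M[R]_(k.+1, p))) @^-1` A.
have mD : measurable D.
  by rewrite -[D]setTI; exact: (@measurable_col_mx_pair R p k measurableT _ mA).
have -> : iid_rows mu k.+1 A = (\int[mu]_u iid_rows mu k (xsection D u))%E by [].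
apply: ge0_le_integral => //; first exact: measurable_fun_xsection.
move=> u _; have -> // : xsection D u = [set V | A (col_mx u V : 'M[R]_(1 + k, p))].
by apply/seteqP; split=> V; rewrite /xsection/= inE.
Qed.

Lemma gauss_mxS_le k p (A : set 'M[R]_(k.+1, p)) (G : 'cV[R]_p -> \bar R) :
  measurable A -> measurable_fun setT G -> (forall v, 0 <= G v)%E ->
  (forall v, gauss_mx k p [set V | A (col_mx v^T V : 'M[R]_(1 + k, p))] <= G v)%E ->
  (gauss_mx k.+1 p A <= \int[gauss_col p]_v G v)%E.
Proof.
move=> mA mG G0 AG.
have mT : measurable_fun setT (fun u : 'rV[R]_p => u^T).
  exact: (measurable_trmx (@measurable_id _ 'rV[R]_p setT)).
apply: (@le_trans _ _ (\int[gauss_row p]_u G u^T)%E).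
  apply: iid_rowsS_le => // [|u]; first exact: (measurableT_comp mG mT).
  by rewrite -{1}[u]trmxK.
rewrite ge0_integral_image_prob//; last exact: (measurableT_comp mG mT).
by under eq_integral do rewrite trmxK.
Qed.

(** The condition on x and y says that the rows of B and U together are linearly independent; it
    later gives the invertibility of the Gram matrix of the design. *)
Definition extendable m k p (B : 'M[R]_(m, p)) (b : 'cV[R]_p) (tau : R) :
    set 'M[R]_(k, p) :=
  [set U | (forall x y, x *m B + y *m U = 0 -> x = 0 :> 'rV_m /\ y = 0 :> 'rV_k) /\
    exists b', [/\ B *m b' = B *m b, U *m b' = 0 & sqnorm b' <= tau]].

(** The existential is removed by testing the minimum-norm solution of the stacked system, which is
    a measurable function of U. *)
Lemma measurable_extendable m k p (B : 'M[R]_(m, p)) b tau :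
  measurable (extendable B b tau : set 'M[R]_(k, p)).
Proof.
pose y := col_mx (B *m b) (0 : 'cV[R]_k).
have mM : measurable_fun setT (fun U : 'M[R]_(k, p) => col_mx B U).
  exact: measurable_col_mx.
have -> : extendable B b tau =
    [set U : 'M[R]_(k, p) | col_mx B U *m (col_mx B U)^T \in unitmx] `&`
    [set U | sqnorm (minnorm (col_mx B U) y) <= tau].
  apply/seteqP; split=> U /=.
    move=> [free [b' [Bb' Ub' b'tau]]].
    have Mu : col_mx B U *m (col_mx B U)^T \in unitmx.
      apply: gram_unitmx => a; rewrite -[a]hsubmxK mul_row_col => /free[-> ->].
      by rewrite row_mx0.
    by split=> //; apply: le_trans b'tau; apply: minnorm_le => //; rewrite mul_col_mx Bb' Ub'.
  move=> [Mu tauM]; split=> [x z|].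
    rewrite -mul_row_col => /(gram_unitmx_inj Mu); rewrite -[RHS]row_mx0.
    exact: eq_row_mx.
  have := mulmx_minnorm y Mu; rewrite mul_col_mx => /eq_col_mx[? ?].
  by exists (minnorm (col_mx B U) y).
apply: measurableI.
  apply: measurable_set_unitmx; apply: measurable_mulmx => //.
  exact: measurable_trmx.
by apply: measurable_set_ler => //; apply: measurable_sqnorm; exact: measurable_minnorm.
Qed.

(** * Adding one row to the constraints *)

Section Step.
Variables (m p : nat) (B : 'M[R]_(m, p)) (b v : 'cV[R]_p).
Hypothesis BB : B *m B^T = 1%:M.
Hypothesis Bb : B^T *m (B *m b) = b.

Definition residual := v - B^T *m (B *m v).

Definition residual_rows := col_mx B ((Num.sqrt (sqnorm residual))^-1 *: residual^T).

(** Moving b along the residual of v leaves B b unchanged and, as v . residual = |residual|^2, makes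
    the result orthogonal to v. *)
Definition residual_shift := b - (dot v b / sqnorm residual) *: residual.

Hypothesis r0 : 0 < sqnorm residual.

Let Br : B *m residual = 0.
Proof. by rewrite mulmxBr !mulmxA BB mul1mx subrr. Qed.

Let rb : dot residual b = 0.
Proof. by rewrite -Bb dot_mulr trmxK Br dotC dot0r. Qed.

Let vr : dot v residual = sqnorm residual.
Proof.
rewrite sqnorm_dot {2}/residual dotDl dotNl dot_mull trmxK Br.
by rewrite dot0r subr0.
Qed.

Lemma sqnorm_residual : sqnorm residual = sqnorm v - sqnorm (B *m v).
Proof.
rewrite -vr /residual dotDr dotNr -sqnorm_dot dot_mulr trmxK.
by rewrite -sqnorm_dot.
Qed.

Lemma residual_rows_orthonormal : residual_rows *m residual_rows^T = 1%:M.
Proof.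
rewrite tr_col_mx mul_col_row BB linearZ/= trmxK -!scalemxAl -!scalemxAr Br.
rewrite -[residual^T *m B^T]trmxK trmx_mul !trmxK Br trmx0 !scaler0 scalerA.
rewrite [residual^T *m residual]mx11_scalar -[_ ord0 ord0]/(dot _ _) -sqnorm_dot.
rewrite scale_scalar_mx -invfM -expr2 sqr_sqrtr ?sqnorm_ge0// mulVf ?gt_eqF//.
by rewrite -scalar_mx_block.
Qed.

Let B_shift : B *m residual_shift = B *m b.
Proof. by rewrite mulmxBr -scalemxAr Br scaler0 subr0. Qed.

Let r_shift : dot residual residual_shift = - dot v b.
Proof.
by rewrite dotDr dotNr dotZr rb -sqnorm_dot divfK ?gt_eqF// add0r.
Qed.

Lemma residual_rows_shift :
  residual_rows^T *m (residual_rows *m residual_shift) = residual_shift.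
Proof.
rewrite tr_col_mx mul_col_mx mul_row_col B_shift Bb linearZ/= trmxK.
rewrite -!scalemxAl -scalemxAr scalerA -invfM -expr2 sqr_sqrtr ?sqnorm_ge0//.
rewrite [residual^T *m _]mx11_scalar -[_ ord0 ord0]/(dot _ _) r_shift.
by rewrite mul_mx_scalar scalerA /residual_shift mulrN scaleNr mulrC.
Qed.

Lemma sqnorm_residual_shift :
  sqnorm residual_shift = sqnorm b + dot v b ^+ 2 / sqnorm residual.
Proof.
rewrite /residual_shift sqnormD sqnormN sqnormZ dotNr dotZr (dotC b) rb.
by rewrite !mulr0 oppr0 mulr0 addr0; congr (_ + _); field; rewrite gt_eqF.
Qed.

(** A nonzero residual makes (B, v) and [residual_rows] span the same space, so independence
    transfers. The prescribed value - v . b of residual . b' cancels the contribution of B to v .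
    b', whence v . b' = 0. *)
Lemma extendable_residual k tau (V : 'M[R]_(k, p)) :
  extendable residual_rows residual_shift tau V ->
  extendable B b tau (col_mx v^T V : 'M[R]_(1 + k, p)).
Proof.
have sr0 : Num.sqrt (sqnorm residual) != 0 by rewrite gt_eqF ?sqrtr_gt0.
have vE : v^T = (B *m v)^T *m B + residual^T.
  by rewrite /residual linearB/= (trmx_mul B^T) trmxK addrC subrK.
move=> [free [b' [Bb' Vb' b'tau]]]; split.
  move=> x y; rewrite -[y]hsubmxK; set c := lsubmx y; set z := rsubmx y.
  rewrite mul_row_col vE mulmxDr addrA addrA mulmxA -mulmxDl => h.
  have := free (row_mx (x + c *m (B *m v)^T) (Num.sqrt (sqnorm residual) *: c)) z.
  rewrite mul_row_col -scalemxAr -scalemxAl scalerA mulVf// scale1r h.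
  move=> /(_ erefl)[+ ->]; rewrite -[RHS]row_mx0 => /eq_row_mx[+ /eqP].
  rewrite scaler_eq0 (negbTE sr0)/= => + /eqP c0.
  by rewrite c0 mul0mx addr0 row_mx0 => ->.
exists b'; move: Bb'; rewrite !mul_col_mx => /eq_col_mx[Bb' rb'].
have {}rb' : dot residual b' = - dot v b.
  move: rb'; rewrite -!scalemxAl => /(scalerI (invr_neq0 sr0)).
  by move=> /matrixP/(_ ord0 ord0); rewrite -r_shift.
rewrite Vb'; split=> //; first by rewrite Bb' B_shift.
have -> : v^T *m b' = 0; last by rewrite col_mx0.
rewrite [LHS]mx11_scalar -[_ ord0 ord0]/(dot _ _).
have -> : dot v b' = 0; last by rewrite raddf0.
have -> : dot v b' = dot (B^T *m (B *m v)) b' + dot residual b'.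
  by rewrite -dotDl addrC subrK.
by rewrite rb' dot_mull trmxK Bb' B_shift dot_mull Bb subrr.
Qed.

End Step.

Lemma extendable_no_row p m (B : 'M[R]_(m, p)) b tau (U : 'M[R]_(0, p)) :
  B *m B^T = 1%:M -> sqnorm b <= tau -> extendable B b tau U.
Proof.
move=> BB btau; split=> [x y|].
  rewrite [U]flatmx0 mulmx0 addr0 => xB; split; last exact: thinmx0.
  by rewrite -[x]mulmx1 -BB mulmxA xB mul0mx.
by exists b; split=> //; rewrite [LHS]flatmx0.
Qed.

(* [rho], rather than [sqnorm b / tau], keeps the case [tau = 0] meaningful;
   [rho ^+ n] is the supermartingale of the row-by-row construction. *)
Lemma gauss_mx_not_extendable n p : (0 < p)%N -> (17 * n <= p)%N ->
  forall k m (B : 'M[R]_(m, p)) b tau rho, (m + k <= 2 * n)%N ->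
  B *m B^T = 1%:M -> B^T *m (B *m b) = b -> 0 <= tau -> 0 <= rho ->
  sqnorm b <= rho * tau ->
  (gauss_mx k p (~` extendable B b tau) <=
   (k%:R * expR (- (2 * n%:R)) + Num.sqrt 2 ^+ k * rho ^+ n)%:E)%E.
Proof.
move=> p0 np; have p0' : 0 < p%:R :> R by rewrite ltr0n.
elim=> [|k IH] m B b tau rho mk BB Bb tau0 rho0 b_le.
  have [btau|taub] := lerP (sqnorm b) tau.
    rewrite (_ : ~` _ = set0) ?measure0 ?lee_fin; last first.
      by rewrite -setCT; congr (~` _); apply/seteqP; split=> // U _;
        exact: extendable_no_row.
    by rewrite mul0r add0r expr0 mul1r exprn_ge0.
  (* Here tau < |b|^2 <= rho tau, which excludes tau = 0 and forces rho > 1; the claimed bound is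
     then at least 1. *)
  apply: (@le_trans _ _ 1%E).
    by apply: probability_le1; apply: measurableC; exact: measurable_extendable.
  rewrite mul0r add0r expr0 mul1r lee_fin exprn_ege1//.
  have := lt_le_trans taub b_le; have [->|tn0] := eqVneq tau 0; first by rewrite mulr0 ltxx.
  rewrite -[X in X < _ -> _]mul1r ltr_pM2r; last by rewrite lt0r tn0.
  exact: ltW.
(* The unit row along b, so that |C v|^2 is the squared Gaussian coordinate driving the growth of
   |b|^2. For b = 0 the inverse of 0 makes C = 0, still a contraction. *)
pose C : 'M[R]_(1, p) := (Num.sqrt (sqnorm b))^-1 *: b^T.
have CT (h : 'cV_1) : sqnorm (C^T *m h) <= sqnorm h.
  rewrite /C linearZ/= trmxK -scalemxAl [h]mx11_scalar mul_mx_scalar.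
  rewrite scalerA sqnormZ exprMn exprVn sqr_sqrtr ?sqnorm_ge0//.
  have -> : sqnorm ((h ord0 ord0)%:M : 'cV_1) = h ord0 ord0 ^+ 2.
    by rewrite /sqnorm big_ord1 mxE eqxx mulr1n.
  have [->|b0] := eqVneq (sqnorm b) 0; first by rewrite mulr0 sqr_ge0.
  by rewrite mulrAC mulVf// mul1r.
have Cv v : dot v b ^+ 2 = sqnorm (C *m v) * sqnorm b.
  have -> : C *m v = ((Num.sqrt (sqnorm b))^-1 * dot v b)%:M.
    rewrite /C -scalemxAl [b^T *m v]mx11_scalar scale_scalar_mx.
    by rewrite -[_ ord0 ord0]/(dot b v) dotC.
  rewrite [sqnorm (_%:M)]big_ord1 mxE eqxx mulr1n exprMn exprVn sqr_sqrtr ?sqnorm_ge0//.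
  have [b0|b0] := eqVneq (sqnorm b) 0; last by rewrite mulrAC mulVf// mul1r.
  by move/eqP: b0; rewrite sqnorm_eq0 => /eqP->; rewrite dot0r expr0n !mulr0 mul0r.
(* On this rare event the residual is too short to control the step, and the failure probability is
   bounded by 1. *)
pose A := [set v : 'cV[R]_p | sqnorm v - sqnorm (B *m v) <= p%:R / 4].
have msq q (D : 'M[R]_(q, p)) : measurable_fun setT (fun v : 'cV[R]_p => sqnorm (D *m v)).
  by apply: measurable_sqnorm; exact: measurable_mulmx.
have mA : measurable A.
  apply: measurable_set_ler => //; apply: measurable_funB => //.
  by apply: measurable_sqnorm; exact: measurable_id.
pose c1 := k%:R * expR (- (2 * n%:R)) : R.
pose c2 := Num.sqrt 2 ^+ k * rho ^+ n : R.
have c10 : 0 <= c1 by rewrite mulr_ge0// expR_ge0.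
have c20 : 0 <= c2 by rewrite mulr_ge0// exprn_ge0// sqrtr_ge0.
(* This is exp (|C v|^2 / 4), written in the form of [gauss_col_expR_contraction]. It dominates the
   n-th power of the growth factor 1 + 4 |C v|^2 / p, and its mean is at most sqrt 2, the factor
   gained per row. *)
pose E v := expR ((1 - 1 ^- 2) / 2 * sqnorm v + (Num.sqrt 2)^-1 ^+ 2 / 2 * sqnorm (C *m v)).
have mE : measurable_fun setT (EFin \o E).
  apply/measurable_EFinP; apply: measurableT_comp => //; apply: measurable_funD.
    by apply: measurable_funM => //; apply: measurable_sqnorm; exact: measurable_id.
  by apply: measurable_funM.
have mIA : measurable_fun setT (fun v => (\1_A v)%:E : \bar R).
  by apply/measurable_EFinP; exact: measurable_indic.
pose G v := ((\1_A v)%:E + (c1%:E + c2%:E * (E v)%:E))%E.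
have G20 v : (0 <= c1%:E + c2%:E * (E v)%:E)%E.
  by rewrite -EFinM -EFinD lee_fin addr_ge0// mulr_ge0// expR_ge0.
have G0 v : (0 <= G v)%E.
  by apply: adde_ge0; [rewrite lee_fin|exact: G20].
have mG2 : measurable_fun setT (fun v => (c1%:E + c2%:E * (E v)%:E)%E).
  by apply: emeasurable_funD => //; exact: emeasurable_funM.
apply: (@le_trans _ _ (\int[gauss_col p]_v G v)%E).
  apply: gauss_mxS_le => //.
  - by apply: measurableC; exact: measurable_extendable.
  - exact: emeasurable_funD.
  - move=> v.
    have mV : measurable [set V : 'M[R]_(k, p) |
        extendable B b tau (col_mx v^T V : 'M[R]_(1 + k, p))].
      have mc : measurable_fun setT (fun V : 'M[R]_(k, p) => col_mx v^T V).
        exact: (measurable_col_mx (measurable_cst v^T) (@measurable_id _ _ _)).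
      rewrite -[X in measurable X]setTI.
      exact: (mc measurableT _ (measurable_extendable B b tau)).
    have [vA|vA] := boolP (v \in A).
      apply: (@le_trans _ _ 1%E).
        by apply: probability_le1; exact: measurableC.
      by rewrite /G indicE vA -[leLHS]adde0 leeD2l.
    rewrite /G indicE (negbTE vA) add0e -EFinM -EFinD.
    have r4 : p%:R / 4 < sqnorm (residual B v).
      by rewrite sqnorm_residual//; move: vA; rewrite notin_setE/= => /negP; rewrite -ltNge.
    have r0 : 0 < sqnorm (residual B v) by rewrite (lt_trans _ r4)// divr_gt0.
    pose g := sqnorm (C *m v); have g0 : 0 <= g by exact: sqnorm_ge0.
    pose rho1 := rho * (1 + 4 * g / p%:R).
    have x0 : 0 <= 4 * g / p%:R by rewrite divr_ge0// mulr_ge0.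
    have rho10 : 0 <= rho1 by rewrite mulr_ge0// addr_ge0.
    have b1_le : sqnorm (residual_shift B b v) <= rho1 * tau.
      rewrite sqnorm_residual_shift// Cv -/g.
      apply: (@le_trans _ _ (sqnorm b * (1 + 4 * g / p%:R))).
        rewrite mulrDr mulr1 lerD2l [leLHS]mulrAC [leLHS]mulrC; apply: ler_wpM2l.
          exact: sqnorm_ge0.
        rewrite ler_pdivrMr// [leRHS]mulrAC ler_pdivlMr// -subr_ge0.
        rewrite (_ : _ - _ = g * (4 * sqnorm (residual B v) - p%:R)); last by ring.
        by rewrite mulr_ge0// subr_ge0; move: r4; lra.
      by rewrite /rho1 [leRHS]mulrAC; apply: ler_wpM2r => //; rewrite addr_ge0.
    have mk1 : (m + 1 + k <= 2 * n)%N by rewrite -addnA add1n.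
    have IH1 := IH _ _ _ tau rho1 mk1
      (residual_rows_orthonormal BB r0) (residual_rows_shift BB Bb r0) tau0 rho10 b1_le.
    apply: (@le_trans _ _ (c1 + Num.sqrt 2 ^+ k * rho1 ^+ n)%:E).
      apply: le_trans IH1; apply: le_measure; rewrite ?inE.
      + exact: measurableC.
      + by apply: measurableC; exact: measurable_extendable.
      + by apply: subsetC => V; exact: extendable_residual.
    rewrite lee_fin lerD2l /c2 /rho1 exprMn mulrA; apply: ler_wpM2l => //.
    apply: (@le_trans _ _ (expR (4 * g / p%:R) ^+ n)).
      by apply: lerXn2r; rewrite ?nnegrE ?expR_ge0 ?addr_ge0// expR_ge1Dx.
    rewrite -expRM_natl ler_expR -/g exprVn sqr_sqrtr// expr1n invr1 subrr !mul0r add0r.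
    rewrite mulrA ler_pdivrMr//.
    have np' : 17 * n%:R <= p%:R :> R by rewrite -natrM ler_nat.
    have n0' : 0 <= n%:R :> R by [].
    rewrite -subr_ge0 (_ : _ - _ = g * (p%:R / 4 - 4 * n%:R)); last by field.
    by rewrite mulr_ge0// subr_ge0; lra.
rewrite ge0_integralD//.
rewrite integral_indic// setIT ge0_integralD//; last 2 first.
- by move=> v _; rewrite -EFinM lee_fin mulr_ge0// expR_ge0.
- exact: emeasurable_funM.
rewrite integral_cst// [X in (_ + (_ * X + _))%E]probability_setT mule1.
rewrite ge0_integralZl//; last by move=> v _; rewrite lee_fin expR_ge0.
have s2 : (Num.sqrt 2)^-1 ^+ 2 * 1 ^+ 2 = 2^-1 :> R.
  by rewrite exprVn sqr_sqrtr// expr1n mulr1.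
have := gauss_col_expR_contraction (@ltr01 R) s2 CT.
rewrite (expr1n _ p) mul1r expr1 => intE.
have mn : (m <= 2 * n)%N by apply: leq_trans mk; exact: leq_addr.
have BT (h : 'cV_m) : sqnorm (B^T *m h) <= sqnorm h by rewrite sqnorm_isometry ?trmxK.
apply: (le_trans (leeD (gauss_col_residual_lower mn np BT) (leeD2l _ (lee_wpmul2l _ intE)))).
  by rewrite lee_fin.
rewrite -EFinM -!EFinD lee_fin /c1 /c2 exprS -[k.+1]addn1 natrD mulrDl.
lra.
Qed.

End Extension.

(** * Haar rotations *)

Section ProductBounds.
Context {R : realType}.

(** Both numbers are compared with the product measure of D, computed by sections in one order and
    then in the other. *)
Lemma probability_swap_le d1 d2 (T1 : measurableType d1) (T2 : measurableType d2)
    (P1 : probability T1 R) (P2 : probability T2 R) (D : set (T1 * T2)) (a c : R) :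
  measurable D ->
  (forall y, a%:E <= P1 [set x | D (x, y)])%E ->
  (forall x, P2 [set y | D (x, y)] <= c%:E)%E -> a <= c.
Proof.
move=> mD aD Dc.
have ysE y : ysection D y = [set x | D (x, y)].
  by apply/seteqP; split=> x; rewrite /ysection/= inE.
have xsE x : xsection D x = [set y | D (x, y)].
  by apply/seteqP; split=> y; rewrite /xsection/= inE.
have cst_int d (T : measurableType d) (P : probability T R) (b : R) :
    (\int[P]_x b%:E = b%:E)%E.
  by rewrite integral_cst//= [X in (_ * X)%E]probability_setT mule1.
have a0 : (0 <= \int[P2]_y (P1 (ysection D y)))%E by apply: integral_ge0.
rewrite -lee_fin; apply: (@le_trans _ _ (\int[P2]_y (P1 (ysection D y)))%E).
  have [a_lt0|a_ge0] := ltP a 0; first by apply: le_trans a0; rewrite lee_fin ltW.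
  rewrite -(cst_int _ _ P2); apply: ge0_le_integral => //.
  - exact: measurable_fun_ysection.
  - by move=> y _; rewrite ysE.
have -> : (\int[P2]_y P1 (ysection D y) = (P1 \x^ P2) D)%E by [].
rewrite -(@product_measure_unique _ _ _ _ _ P1 P2 (P1 \x^ P2)%E)//; last first.
  by move=> A B mA mB; exact: product_measure2E.
rewrite -(cst_int _ _ P1); apply: ge0_le_integral => //.
- exact: measurable_fun_xsection.
- by move=> x _; have := Dc x; rewrite -xsE.
Qed.

(** Products of rectangles are a pi-system generating the product sigma-algebra, which is what
    identifies a joint law from independence on rectangles. *)
Lemma measurable_prod_mx_rects m n p q :
  @measurable _ ('M[R]_(m, n) * 'M[R]_(p, q))%type =
  <<s [set A `*` B | A in @mx_rects R m n & B in @mx_rects R p q] >>.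
Proof.
set G := [set A `*` B | A in _ & B in _].
have mT a b : @mx_rects R a b setT.
  by exists (fun _ _ => setT) => //; apply/seteqP; split.
apply/seteqP; split.
  have mfst : measurable_fun setT
      (fst : g_sigma_algebraType G -> 'M[R]_(m, n)).
    apply: (@measurability _ _ _ _ _ _ (@mx_rects R m n)) => // _ [_ [C mC ->] <-].
    rewrite setTI; apply: sub_sigma_algebra; exists (mx_rect C); first by exists C.
    by exists setT => //; apply/seteqP; split=> [[x y]|[x y]] //= [].
  have msnd : measurable_fun setT
      (snd : g_sigma_algebraType G -> 'M[R]_(p, q)).
    apply: (@measurability _ _ _ _ _ _ (@mx_rects R p q)) => // _ [_ [C mC ->] <-].
    rewrite setTI; apply: sub_sigma_algebra; exists setT => //.
    exists (mx_rect C); first by exists C.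
    by apply/seteqP; split=> [[x y]|[x y]] //= [].
  have mid : measurable_fun setT (fun z : g_sigma_algebraType G =>
      (z : 'M[R]_(m, n) * 'M[R]_(p, q))).
    exact/measurable_fun_pairP.
  by move=> A mA; have := mid measurableT A mA; rewrite setTI.
apply: smallest_sub; first exact: sigma_algebra_measurable.
move=> _ [_ [C mC ->] [_ [D mD ->] <-]].
by apply: measurableX; exact: measurable_mx_rect.
Qed.

Section IndependentMatrices.
Context {d : measure_display} {T : measurableType d} (P : probability T R).
Variables (m n p q : nat) (xi : T -> 'M[R]_(m, n)) (O : T -> 'M[R]_(p, q)).
Hypothesis mxi : measurable_fun setT xi.
Hypothesis mO : measurable_fun setT O.
Hypothesis indep : forall C D, (forall i j, measurable (C i j)) ->
  (forall i j, measurable (D i j)) ->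
  P (xi @^-1` mx_rect C `&` O @^-1` mx_rect D) =
  (P (xi @^-1` mx_rect C) * P (O @^-1` mx_rect D))%E.

Lemma independent_section_le (S : set ('M[R]_(m, n) * 'M[R]_(p, q))) (c : R) :
  measurable S ->
  (forall M, P [set t | S (M, O t)] <= c%:E)%E -> (P [set t | S (xi t, O t)] <= c%:E)%E.
Proof.
move=> mS Sc.
have mpair : measurable_fun setT (fun t => (xi t, O t)) by exact: measurable_fun_pair.
have -> : P [set t | S (xi t, O t)] = image_prob P mpair S by [].
have -> : image_prob P mpair S = (image_prob P mxi \x image_prob P mO)%E S.
  have mT a b : @mx_rects R a b setT.
    by exists (fun _ _ => setT) => //; apply/seteqP; split.
  apply: (measure_unique _ (fun=> setT) (measurable_prod_mx_rects m n p q)) => //.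
  - move=> _ _ [A1 rA1 [B1 rB1 <-]] [A2 rA2 [B2 rB2 <-]].
    exists (A1 `&` A2); first exact: mx_rects_setI.
    by exists (B1 `&` B2); [exact: mx_rects_setI|rewrite setXI].
  - by move=> _; exists setT => //; exists setT => //; rewrite setXTT.
  - by rewrite bigcup_const//; exists 0%N.
  - move=> _ [_ [C mC ->] [_ [D mD ->] <-]].
    rewrite [RHS]product_measure1E; [exact: (indep mC mD)| |]; exact: measurable_mx_rect.
  - by move=> _; rewrite [X in (X < _)%E]probability_setT ltry.
apply: (@le_trans _ _ (\int[image_prob P mxi]_M c%:E)%E).
  apply: ge0_le_integral => //.
  - exact: measurable_fun_xsection.
  - move=> M _; apply: le_trans (Sc M); rewrite image_probE /xsection.
    by rewrite le_eqVlt; apply/orP; left; apply/eqP; congr (P _);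
      apply/seteqP; split=> t; rewrite /= inE.
- exact: measurable_id.
- by rewrite integral_cst//= [X in (_ * X)%E]probability_setT mule1.
Qed.

End IndependentMatrices.

End ProductBounds.

(** * Tail bounds for a Haar rotation of a fixed vector *)

Section Haar.
Context {R : realType} {d : measure_display} {T : measurableType d}.
Variables (P : probability T R) (p : nat) (O : T -> 'M[R]_p).
Hypothesis p0 : (0 < p)%N.
Hypothesis mO : measurable_fun setT O.
Hypothesis haarO : haar_orthogonal P O.

Lemma haar_left_invariant (Q : 'M[R]_p) (A : set 'M[R]_p) :
  Q *m Q^T = 1%:M -> measurable A -> P [set t | A (Q *m O t)] = P [set t | A (O t)].
Proof.
move=> QQ mA.
have mQO : measurable_fun setT (fun t => Q *m O t) by exact: measurable_mulmx.
rewrite -[LHS]/(image_prob P mQO A) -[RHS]/(image_prob P mO A).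
apply: mx_rects_unique => // [|C mC].
  by rewrite [X in (X < _)%E]probability_setT ltry.
have := haarO.2 Q QQ (fun k => C k.1 k.2) (fun k => mC k.1 k.2).
have rectE (M : T -> 'M[R]_p) : \bigcap_(k in [set: 'I_p * 'I_p])
    [set t | M t k.1 k.2 \in C k.1 k.2] = M @^-1` mx_rect C.
  apply/seteqP; split=> t; last by move=> Ct [i j] _ /=; rewrite inE; exact: Ct.
  by move=> Ct i j; have := Ct (i, j) I; rewrite /= inE.
by rewrite !rectE.
Qed.

Variables (m n : nat) (C : 'M[R]_(m, p)).
Hypothesis CC : C *m C^T = 1%:M.
Hypothesis mn : (m <= n)%N.
Hypothesis np : (17 * n <= p)%N.

Let kappa : R := 4 * (n%:R / p%:R).

Let mOtr : measurable_fun setT (fun t => (O t)^T).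
Proof. exact: measurable_trmx. Qed.

(** With Q e = a v, replacing O by Q O turns O^T e into O^T (a v), so e may be exchanged for any
    Gaussian v up to scale. For a fixed rotation, C O^T is a contraction in the required sense and
    [gauss_col_ratio_upper] applies to v; [probability_swap_le] joins the two. *)
Lemma haar_trmx_tail (e : 'cV[R]_p) :
  (P [set t | (kappa * sqnorm e < sqnorm (C *m (O t)^T *m e))%R] <=
   (2 * expR (- (n%:R / 8)))%:E)%E.
Proof.
have m2 : measurable_fun setT (fun z : T * 'cV[R]_p => z.2) by exact: measurable_snd.
have mO1 : measurable_fun setT (fun z : T * 'cV[R]_p => (O z.1)^T).
  exact: (measurableT_comp mOtr measurable_fst).
pose D := [set z : T * 'cV[R]_p |
  kappa * sqnorm z.2 <= sqnorm (C *m (O z.1)^T *m z.2)].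
have mD : measurable D.
  apply: measurable_set_ler.
    by apply: measurable_funM => //; exact: measurable_sqnorm.
  by apply: measurable_sqnorm; do 2 apply: measurable_mulmx => //.
have mtail : measurable [set M : 'M[R]_p | kappa * sqnorm e < sqnorm (C *m M^T *m e)].
  apply: measurable_set_ltr => //; apply: measurable_sqnorm.
  do 2 apply: measurable_mulmx => //.
  exact: (measurable_trmx (@measurable_id _ 'M[R]_p setT)).
set S := [set t | _].
have mS : measurable S by have := mO measurableT mtail; rewrite setTI.
have PS : P S \is a fin_num by exact: fin_num_measure.
rewrite -(fineK PS) lee_fin.
apply: (@probability_swap_le _ _ _ _ _ P (gauss_col p) D _ _ mD) => [v|t].
  rewrite fineK//.
  have mDv : measurable [set t | D (t, v)].
    by rewrite -[X in measurable X]setTI; exact: (@pair2_measurable _ _ T _ v measurableT _ mD).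
  (* No reflection sends e to a multiple of v = 0 in general. The non-strict inequality in [D] makes
     the section at 0 the whole space. *)
  have [->|v0] := eqVneq v 0.
    rewrite (_ : [set t | D (t, 0)] = setT) ?probability_setT ?probability_le1//.
    apply/seteqP; split=> // t _; rewrite /D/=.
    rewrite (_ : sqnorm (0 : 'cV[R]_p) = 0) ?mulr0 ?sqnorm_ge0//.
    by apply/eqP; rewrite sqnorm_eq0.
  pose a := Num.sqrt (sqnorm e / sqnorm v).
  have a2 : a ^+ 2 * sqnorm v = sqnorm e.
    by rewrite sqr_sqrtr ?divr_ge0 ?sqnorm_ge0// divfK// sqnorm_eq0.
  have [Q [QQ Qe]] : exists Q : 'M[R]_p, Q *m Q^T = 1%:M /\ Q *m e = a *: v.
    by apply: householder; rewrite sqnormZ a2.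
  have eE : e = Q^T *m (a *: v) by rewrite -Qe mulmxA (mulmx1C QQ) mul1mx.
  pose A := [set M : 'M[R]_p | kappa * sqnorm e < sqnorm (C *m M^T *m (a *: v))].
  have mA : measurable A.
    apply: measurable_set_ltr => //; apply: measurable_sqnorm.
    do 2 apply: measurable_mulmx => //.
    exact: (measurable_trmx (@measurable_id _ 'M[R]_p setT)).
  have -> : S = [set t | A (Q *m O t)].
    by apply/seteqP; split=> t; rewrite /S /A/= trmx_mul -!mulmxA -eE.
  rewrite (haar_left_invariant QQ mA); apply: le_measure; rewrite ?inE//.
    by rewrite -[X in measurable X]setTI; exact: (mO measurableT mA).
  move=> t; rewrite /A /D/= -scalemxAr sqnormZ -a2 mulrCA.
  have [->|a0] := eqVneq a 0; first by rewrite expr0n !mul0r ltxx.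
  by rewrite ltr_pM2l ?exprn_even_gt0// => /ltW.
have OTO : (O t)^T *m O t = 1%:M by apply: mulmx1C; exact: haarO.1.
apply: (@gauss_col_ratio_upper R m p n (C *m (O t)^T) p0 mn np) => h.
by rewrite trmx_mul trmxK -mulmxA !sqnorm_isometry ?trmxK.
Qed.

(** Left invariance cannot move w inside O w. For every fixed O', however, O'^T O has the law of O,
    and for fixed O the vector O w has the norm of w, so [haar_trmx_tail] applies with O' as the
    random rotation. *)
Lemma haar_tail (w : 'cV[R]_p) :
  (P [set t | (kappa * sqnorm w < sqnorm (C *m O t *m w))%R] <=
   (2 * expR (- (n%:R / 8)))%:E)%E.
Proof.
pose D := [set z : T * T |
  kappa * sqnorm w < sqnorm (C *m (O z.2)^T *m O z.1 *m w)].
have mO1 : measurable_fun setT (fun z : T * T => O z.1).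
  exact: (measurableT_comp mO measurable_fst).
have mO2 : measurable_fun setT (fun z : T * T => (O z.2)^T).
  exact: (measurableT_comp mOtr measurable_snd).
have mD : measurable D.
  apply: measurable_set_ltr => //; apply: measurable_sqnorm.
  by do 3 apply: measurable_mulmx => //.
have mA : measurable [set M : 'M[R]_p | kappa * sqnorm w < sqnorm (C *m M *m w)].
  apply: measurable_set_ltr => //; apply: measurable_sqnorm.
  by do 2 apply: measurable_mulmx => //.
set S := [set t | _].
have mS : measurable S by have := mO measurableT mA; rewrite setTI.
have PS : P S \is a fin_num by exact: fin_num_measure.
rewrite -(fineK PS) lee_fin.
apply: (@probability_swap_le _ _ _ _ _ P P D _ _ mD) => [t'|t].
  rewrite fineK//.
  have QQ : (O t')^T *m (O t')^T^T = 1%:M.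
    by rewrite trmxK; apply: mulmx1C; exact: haarO.1.
  rewrite -[P S]/(P [set t | [set M : 'M[R]_p |
    kappa * sqnorm w < sqnorm (C *m M *m w)] (O t)]).
  rewrite -(haar_left_invariant QQ mA).
  by under eq_set do rewrite /= mulmxA.
have OTO : (O t)^T *m O t = 1%:M by apply: mulmx1C; exact: haarO.1.
have := haar_trmx_tail (O t *m w); rewrite sqnorm_isometry//.
by under eq_set do rewrite mulmxA.
Qed.

End Haar.

(** * The latent space model *)

Section Model.
Context {R : realType}.

Lemma measurable_riskA d0 (T : measurableType d0) p d (W : 'M[R]_(p, d)) theta
    (f : T -> 'cV[R]_p) :
  measurable_fun setT f -> measurable_fun setT (fun t => riskA W theta (f t)).
Proof.
move=> mf; apply: measurable_funD => //.
have mfb : measurable_fun setT (fun t => f t - beta_star W theta).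
  exact: measurable_addmx.
apply: (measurableT_comp (measurable_entry _ _)).
by do 2 apply: measurable_mulmx => //; exact: measurable_trmx.
Qed.

Lemma measurable_beta_BA d0 (T : measurableType d0) n p (f g : T -> 'M[R]_(n, p))
    (y : T -> 'cV[R]_n) :
  measurable_fun setT f -> measurable_fun setT g -> measurable_fun setT y ->
  measurable_fun setT (fun t => beta_BA (f t) (g t) (y t)).
Proof.
move=> mf mg my; apply: measurable_addmx.
  by apply: measurable_addmx; exact: measurable_minnorm.
apply: measurable_oppmx; apply: measurable_mulmx; last exact: measurable_minnorm.
have mgT : measurable_fun setT (fun t => (g t)^T) by exact: measurable_trmx.
have mgTT : measurable_fun setT (fun t => (g t)^T^T) by exact: measurable_trmx.
rewrite /colproj; apply: measurable_mulmx => //; apply: measurable_mulmx => //.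
by apply: measurable_invmx; exact: measurable_mulmx.
Qed.

Lemma gauss_mx_not_extendable_tail n d p (B : 'M[R]_(d, p)) b tau :
  (0 < p)%N -> (d <= n)%N -> (17 * n <= p)%N ->
  B *m B^T = 1%:M -> B^T *m (B *m b) = b -> 0 <= tau -> sqnorm b = 4^-1 * tau ->
  (gauss_mx n p (~` extendable B b tau) <= (2 * expR (- (n%:R / 8)))%:E)%E.
Proof.
move=> p0 dn np BB Bb tau0 btau.
have dn2 : (d + n <= 2 * n)%N by rewrite mul2n -addnn leq_add2r.
have rho0 : 0 <= 4^-1 :> R by [].
have le_b : sqnorm b <= 4^-1 * tau by rewrite btau.
apply: (le_trans (gauss_mx_not_extendable p0 np dn2 BB Bb tau0 rho0 le_b)).
have n0 : 0 <= n%:R :> R by [].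
rewrite lee_fin [leRHS]mulr_natl mulr2n; apply: lerD.
  (* The union over rows is absorbed by n <= exp n. *)
  apply: (@le_trans _ _ (expR n%:R * expR (- (2 * n%:R)))).
    apply: ler_wpM2r; first exact: expR_ge0.
    by apply: le_trans (expR_ge1Dx _); rewrite ler_wpDl.
  by rewrite -expRD ler_expR; lra.
(* With rho = 1/4 the moment term is (sqrt 2 / 4) ^ n = 2^(-3 n / 2), at most exp (- n) because 1 /
   sqrt 2 <= exp (- 1/3). *)
rewrite -exprMn; have -> : Num.sqrt 2 * 4^-1 = (Num.sqrt 2)^-1 ^+ 3 :> R.
  have s0 : Num.sqrt 2 != 0 :> R by rewrite gt_eqF// sqrtr_gt0.
  apply: (mulfI s0); rewrite mulrA -expr2 sqr_sqrtr// exprS mulrA divff// mul1r.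
  by rewrite exprVn sqr_sqrtr//; field.
rewrite -exprM; apply: (@le_trans _ _ (expR (- (1 / 3)) ^+ (3 * n))).
  by apply: lerXn2r; rewrite ?nnegrE ?expR_ge0 ?invr_ge0 ?sqrtr_ge0//;
    exact: invr_sqrt2_le_expR.
by rewrite -expRM_natl ler_expR natrM; lra.
Qed.

(** The statement is deterministic and holds for every Z: a X = 0 reads (a Z) W^T + a U = 0, a
    relation between the rows of W^T and U, and b' interpolates whatever Z is. *)
Lemma extendable_design n d p (W : 'M[R]_(p, d)) theta s2 (Z : 'M[R]_(n, d))
    (U : 'M[R]_(n, p)) :
  0 < s2 -> W^T *m W = s2%:M ->
  extendable ((Num.sqrt s2)^-1 *: W^T) (s2^-1 *: (W *m theta))
    (4 / s2 * sqnorm theta) U ->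
  let X := XA W Z U in X *m X^T \in unitmx /\
    s2 * sqnorm (minnorm X (yvec theta Z)) <= 4 * sqnorm theta.
Proof.
move=> s0 WW [free [b' [Bb' Ub' b'tau]]] X.
have ss0 : Num.sqrt s2 != 0 by rewrite gt_eqF// sqrtr_gt0.
have Xu : X *m X^T \in unitmx.
  apply: gram_unitmx => a aX.
  have [//|_ ->//] := free (Num.sqrt s2 *: (a *m Z)) a.
  by rewrite -scalemxAr -scalemxAl scalerA mulVf// scale1r -mulmxA -mulmxDr.
split=> //.
have Wb' : W^T *m b' = theta.
  move: Bb'; rewrite -!scalemxAl => /(scalerI (invr_neq0 ss0)) ->.
  by rewrite -scalemxAr mulmxA WW mul_scalar_mx scalerA mulVf ?gt_eqF// scale1r.
have Xb' : X *m b' = yvec theta Z.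
  by rewrite /X /XA mulmxDl -mulmxA Wb' Ub' addr0.
have := le_trans (minnorm_le Xu Xb') b'tau.
by rewrite mulrAC ler_pdivlMr// mulrC.
Qed.

Section Laws.
Context {d0 : measure_display} {T : measurableType d0}.
Variables (P : probability T R) (n d p : nat).
Variables (Z : T -> 'M[R]_(n, d)) (U : T -> 'M[R]_(n, p)) (O : T -> 'M[R]_p).

Lemma law_noise (mU : measurable_fun setT U) :
  mutually_independent P (ZU_entries Z U) ->
  (forall k, std_normal_rv P (ZU_entries Z U k)) ->
  forall A, measurable A -> P (U @^-1` A) = gauss_mx n p A.
Proof.
move=> indep std A mA; rewrite -[LHS]/(image_prob P mU A).
apply: mx_rects_unique => // [|C mC].
  by rewrite [X in (X < _)%E]probability_setT ltry.
apply: etrans (esym (gauss_mx_rect mC)).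
rewrite -[LHS]/(P (U @^-1` mx_rect C)).
pose B (k : ('I_n * 'I_d) + ('I_n * 'I_p)) : set R :=
  match k with inl _ => setT | inr ij => C ij.1 ij.2 end.
have mB k : measurable (B k) by case: k => [|[i j]] /=.
have -> : U @^-1` mx_rect C = \bigcap_(k in setT) (ZU_entries Z U k @^-1` B k).
  apply/seteqP; split=> t; first by move=> Ct [//|[i j]] _; exact: Ct.
  by move=> Ct i j; exact: (Ct (inr (i, j))).
rewrite indep// big_sumType/= big1 ?mul1e; last first.
  by move=> k _; rewrite preimage_setT probability_setT.
rewrite pair_big/=; apply: eq_bigr => -[i j] _.
exact: (std (inr (i, j))).
Qed.

Lemma independent_design_rotation :
  independent_vectors P (ZU_entries Z U) (O_entries O) ->
  forall C D, (forall i j, measurable (C i j)) -> (forall i j, measurable (D i j)) ->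
  P ((fun t => row_mx (Z t) (U t)) @^-1` mx_rect C `&` O @^-1` mx_rect D) =
  (P ((fun t => row_mx (Z t) (U t)) @^-1` mx_rect C) * P (O @^-1` mx_rect D))%E.
Proof.
move=> indep C D mC mD.
pose B (k : ('I_n * 'I_d) + ('I_n * 'I_p)) : set R :=
  match k with inl ij => C ij.1 (lshift p ij.2) | inr ij => C ij.1 (rshift d ij.2) end.
have mB k : measurable (B k) by case: k => [[i j]|[i j]] /=.
have -> : (fun t => row_mx (Z t) (U t)) @^-1` mx_rect C =
    \bigcap_(k in setT) (ZU_entries Z U k @^-1` B k).
  apply/seteqP; split=> t.
    move=> Ct [] [i j] _ /=; first by have := Ct i (lshift p j); rewrite row_mxEl.
    by have := Ct i (rshift d j); rewrite row_mxEr.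
  move=> Ct i j; rewrite -[j]splitK; case: (fintype.split j) => k /=.
    by rewrite row_mxEl; exact: (Ct (inl (i, k))).
  by rewrite row_mxEr; exact: (Ct (inr (i, k))).
have -> : O @^-1` mx_rect D =
    \bigcap_(k in setT) (O_entries O k @^-1` (fun k => D k.1 k.2) k).
  apply/seteqP; split=> t; first by move=> Dt [i j] _; exact: Dt.
  by move=> Dt i j; exact: (Dt (i, j)).
by apply: indep.
Qed.

End Laws.

End Model.

(** * Failure events of the rotation *)

Section BadEvents.
Context {R : realType}.
Variables (n d p : nat) (W : 'M[R]_(p, d)) (theta : 'cV[R]_d).

(** Z and U are glued into one matrix M, so that the data and O form a pair of random matrices, as
    [independent_section_le] requires. *)
Definition design (M : 'M[R]_(n, d + p)) : 'M[R]_(n, p) := XA W (lsubmx M) (rsubmx M).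

Definition design_minnorm (M : 'M[R]_(n, d + p)) : 'cV[R]_p :=
  minnorm (design M) (yvec theta (lsubmx M)).

Lemma measurable_design : measurable_fun setT design.
Proof.
apply: measurable_addmx; last exact: (measurable_rsubmx (@measurable_id _ _ _)).
by apply: measurable_mulmx => //; exact: (measurable_lsubmx (@measurable_id _ _ _)).
Qed.

Lemma measurable_design_minnorm : measurable_fun setT design_minnorm.
Proof.
apply: measurable_minnorm; first exact: measurable_design.
by apply: measurable_mulmx => //; exact: (measurable_lsubmx (@measurable_id _ _ _)).
Qed.

Variables (m : nat) (B : 'M[R]_(m, p)) (kappa : R).

Definition bad_image : set ('M[R]_(n, d + p) * 'M[R]_p) :=
  [set z | let e := design_minnorm z.1 in kappa * sqnorm e < sqnorm (B *m z.2 *m e)].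

(** The restriction to invertible Gram matrices is what [gram_schmidt] needs; singular designs are
    charged to the failure of [extendable]. *)
Definition bad_projection : set ('M[R]_(n, d + p) * 'M[R]_p) :=
  [set z | design z.1 *m (design z.1)^T \in unitmx] `&`
  [set z | let e := design_minnorm z.1 in
    kappa * sqnorm e < sqnorm (rowproj (design z.1) *m z.2^T *m e)].

Let T := ('M[R]_(n, d + p) * 'M[R]_p)%type.

Let me : measurable_fun setT (fun z : T => design_minnorm z.1).
Proof. exact: (measurableT_comp measurable_design_minnorm measurable_fst). Qed.

Let mX : measurable_fun setT (fun z : T => design z.1).
Proof. exact: (measurableT_comp measurable_design measurable_fst). Qed.

Let mQ : measurable_fun setT (fun z : T => z.2).
Proof. exact: measurable_snd. Qed.

Lemma measurable_bad_image : measurable bad_image.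
Proof.
apply: measurable_set_ltr; last first.
  by apply: measurable_sqnorm; do 2 apply: measurable_mulmx => //.
by apply: measurable_funM => //; exact: measurable_sqnorm.
Qed.

Lemma measurable_bad_projection : measurable bad_projection.
Proof.
have mXT : measurable_fun setT (fun z : T => (design z.1)^T) by exact: measurable_trmx.
have mXX : measurable_fun setT (fun z : T => design z.1 *m (design z.1)^T).
  exact: measurable_mulmx.
apply: measurableI; first exact: measurable_set_unitmx.
apply: measurable_set_ltr.
  by apply: measurable_funM => //; exact: measurable_sqnorm.
apply: measurable_sqnorm; do 2 apply: measurable_mulmx => //.
  rewrite /rowproj; do 2 apply: measurable_mulmx => //.
  exact: measurable_invmx.
exact: measurable_trmx.
Qed.

End BadEvents.

Unset Implicit Arguments.

Theorem theorem1 (R : realType) :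
  exists c : R, 0 < c /\
  forall (d n p : nat) (gamma : R) (theta : 'cV[R]_d) (W : 'M[R]_(p, d)),
  (0 < d)%N -> (0 < n)%N -> (0 < p)%N -> (d <= n)%N -> 0 < gamma ->
  (17 * n <= p)%N -> gamma^-1 <= p%:R ->
  W^T *m W = (p%:R * gamma)%:M ->
  forall (d0 : measure_display) (T : measurableType d0) (P : probability T R)
         (Z : T -> 'M[R]_(n, d)) (U : T -> 'M[R]_(n, p)) (O : T -> 'M[R]_p),
  (forall i j, measurable_fun setT (fun t => Z t i j)) ->
  (forall i j, measurable_fun setT (fun t => U t i j)) ->
  (forall i j, measurable_fun setT (fun t => O t i j)) ->
  mutually_independent P (ZU_entries Z U) ->
  (forall k, std_normal_rv P (ZU_entries Z U k)) ->
  independent_vectors P (ZU_entries Z U) (O_entries O) ->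
  haar_orthogonal P O ->
  ((1 - 10 * expR (- c * d%:R))%:E <= P [set t | let XAt := XA W (Z t) (U t) in
             let XBt := XAt *m (O t)^T in
             let y := yvec theta (Z t) in
             (riskA W theta (beta_BA XAt XBt y) - riskA W theta (minnorm XAt y)
             <= (66 * Num.sqrt (n%:R / p%:R) + 12 / (p%:R * gamma)) * sqnorm theta)%R])%E.
Proof.
(* The proof gives the rate n / 8, and d <= n. *)
exists (1 / 8); split; first by [].
move=> d n p gamma theta W _ n0 p0 dn g0 np pg WW d0 T P Z U O.
move=> /measurable_mxP mZ /measurable_mxP mU /measurable_mxP mO indep std indepO haarO.
set G := [set t | _].
have p0' : 0 < p%:R :> R by rewrite ltr0n.
set s2 := p%:R * gamma in WW G *; have s2_ge1 : 1 <= s2.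
  by move: pg; rewrite -[gamma^-1]mul1r ler_pdivrMr.
have s2_gt0 : 0 < s2 by exact: lt_le_trans s2_ge1.
set q := Num.sqrt (n%:R / p%:R) in G *.
have q2 : q ^+ 2 = n%:R / p%:R by rewrite sqr_sqrtr// divr_ge0.
have q_range : 0 <= q <= 4^-1.
  rewrite sqrtr_ge0/= -(ler_pXn2r (ltn0Sn 1)) ?nnegrE ?sqrtr_ge0// q2 ler_pdivrMr//.
  have : 17 * n%:R <= p%:R :> R by rewrite -natrM ler_nat.
  by have : 0 <= n%:R :> R by []; lra.
have ss2 : (Num.sqrt s2)^-1 * (Num.sqrt s2)^-1 = s2^-1.
  by rewrite -invfM -expr2 sqr_sqrtr// ltW.
pose B := (Num.sqrt s2)^-1 *: W^T; pose b := s2^-1 *: (W *m theta).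
(* Since |b|^2 = |theta|^2 / s2, [tau] lets the squared norm grow by a factor 4, hence rho = 1/4;
   [kappa] is 4 q^2. *)
pose tau := 4 / s2 * sqnorm theta; pose kappa : R := 4 * (n%:R / p%:R).
have BT : B^T = (Num.sqrt s2)^-1 *: W by rewrite /B linearZ/= trmxK.
have BB : B *m B^T = 1%:M.
  rewrite BT /B -scalemxAl -scalemxAr WW scalerA ss2 scale_scalar_mx.
  by rewrite mulVf// gt_eqF.
have BTB : B^T *m B = s2^-1 *: (W *m W^T).
  by rewrite BT /B -scalemxAl -scalemxAr scalerA ss2.
have Bb : B^T *m (B *m b) = b.
  rewrite mulmxA BTB /b -scalemxAl -scalemxAr -mulmxA (mulmxA W^T) WW mul_scalar_mx.
  by rewrite -scalemxAr !scalerA mulVf ?gt_eqF// mulr1.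
have b_tau : sqnorm b = 4^-1 * tau.
  rewrite /b sqnormZ sqnorm_dot dot_mull mulmxA WW mul_scalar_mx dotZr -sqnorm_dot.
  by rewrite /tau; field; rewrite gt_eqF.
have tau0 : 0 <= tau by rewrite mulr_ge0 ?sqnorm_ge0// divr_ge0// ltW.
have mZU : measurable_fun setT (fun t => row_mx (Z t) (U t)) by exact: measurable_row_mx.
pose ext : set 'M[R]_(n, p) := extendable B b tau.
have mext : measurable (~` ext) by apply: measurableC; exact: measurable_extendable.
pose pair t := (row_mx (Z t) (U t), O t).
have mpair : measurable_fun setT pair by exact: measurable_fun_pair.
pose bad1 := U @^-1` (~` ext).
pose bad2 := pair @^-1` bad_image (n:=n) W theta B kappa.
pose bad3 := pair @^-1` bad_projection (n:=n) W theta kappa.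
have mbad1 : measurable bad1 by have := mU measurableT _ mext; rewrite setTI.
have mbad2 : measurable bad2.
  by have := mpair measurableT _ (@measurable_bad_image R n d p W theta d B kappa); rewrite setTI.
have mbad3 : measurable bad3.
  by have := mpair measurableT _ (@measurable_bad_projection R n d p W theta kappa); rewrite setTI.
have P1 : (P bad1 <= (2 * expR (- (n%:R / 8)))%:E)%E.
  rewrite (law_noise mU indep std)//; exact: gauss_mx_not_extendable_tail.
have P2 : (P bad2 <= (2 * expR (- (n%:R / 8)))%:E)%E.
  apply: (independent_section_le mZU mO (independent_design_rotation indepO)) => [|M].
    exact: measurable_bad_image.
  exact: (haar_tail p0 mO haarO BB dn np (design_minnorm W theta M)).
have P3 : (P bad3 <= (2 * expR (- (n%:R / 8)))%:E)%E.
  apply: (independent_section_le mZU mO (independent_design_rotation indepO)) => [|M].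
    exact: measurable_bad_projection.
  have [Xu|Xu] := boolP (design W M *m (design W M)^T \in unitmx); last first.
    rewrite (_ : [set t | _] = set0) ?measure0 ?lee_fin ?mulr_ge0 ?expR_ge0//.
    by rewrite -subset0 => t [/=]; rewrite (negbTE Xu).
  have [C [CC CE]] := gram_schmidt Xu.
  have := haar_trmx_tail p0 mO haarO CC (leqnn n) np (design_minnorm W theta M).
  congr (P _ <= _)%E; apply/seteqP; split=> t /=.
    by rewrite /bad_projection/= -(mulmxA (rowproj _)) CE mulmxA; split.
  by rewrite /bad_projection/= -(mulmxA (rowproj _)) CE mulmxA => -[].
have mG : measurable G.
  have mX : measurable_fun setT (fun t => XA W (Z t) (U t)).
    by apply: measurable_addmx => //; exact: measurable_mulmx.
  have my : measurable_fun setT (fun t => yvec theta (Z t)) by exact: measurable_mulmx.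
  apply: measurable_set_ler => //; apply: measurable_funB; apply: measurable_riskA.
    apply: measurable_beta_BA => //; apply: measurable_mulmx => //.
    exact: measurable_trmx.
  exact: measurable_minnorm.
have badG : ~` (bad1 `|` (bad2 `|` bad3)) `<=` G.
  move=> t; rewrite !setCU => -[/contrapT Uext [/negP nb2 nb3]].
  have [Xu e_le] := extendable_design (Z t) s2_gt0 WW Uext.
  have eE : design_minnorm W theta (row_mx (Z t) (U t)) =
      minnorm (XA W (Z t) (U t)) (yvec theta (Z t)).
    by rewrite /design_minnorm /design row_mxKl row_mxKr.
  have XE : design W (row_mx (Z t) (U t)) = XA W (Z t) (U t).
    by rewrite /design row_mxKl row_mxKr.
  rewrite /G/=; apply: (risk_gap_le s2_ge1 q_range WW Xu _ e_le) => //.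
  - exact: haarO.1.
  - move: nb2; rewrite -leNgt/= eE q2 => nb2.
    (* [bad_image] speaks of the orthonormal rows of [B], so the bound on W^T is divided by s2. *)
    rewrite mulrC -ler_pdivrMr//; apply: le_trans nb2.
    rewrite le_eqVlt; apply/orP; left; apply/eqP.
    by rewrite /B -!scalemxAl sqnormZ expr2 ss2 mulrC.
  - rewrite q2 leNgt; apply/negP => h; apply: nb3; split=> /=.
      by rewrite XE.
    by rewrite eE XE.
have mbad : measurable (bad1 `|` (bad2 `|` bad3)).
  by apply: measurableU => //; exact: measurableU.
apply: (@le_trans _ _ (P (~` (bad1 `|` (bad2 `|` bad3))))); last first.
  by apply: le_measure; rewrite ?inE//; exact: measurableC.
rewrite probability_setC//.
have Pbad : (P (bad1 `|` (bad2 `|` bad3)) <= (6 * expR (- (n%:R / 8)))%:E)%E.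
  apply: (le_trans (measureU2 _ mbad1 (measurableU _ _ mbad2 mbad3))).
  apply: (le_trans (leeD P1 (le_trans (measureU2 _ mbad2 mbad3) (leeD P2 P3)))).
  by rewrite -!EFinD lee_fin; lra.
apply: (@le_trans _ _ (1 - (6 * expR (- (n%:R / 8)))%:E)%E); last exact: leeB.
rewrite -EFinB lee_fin lerD2l lerN2.
have : expR (- (n%:R / 8)) <= expR (- (1 / 8) * d%:R) :> R.
  have dn' : d%:R <= n%:R :> R by rewrite ler_nat.
  by rewrite ler_expR; lra.
by have := expR_ge0 (- (1 / 8) * d%:R : R); lra.
Qed.
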